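(* If $p \geq 5$ is a Sophie Germain prime, then $\delta_{\mathcal{S}}(A_{2p+1}) \in \{4,5\}$.
   Context: A prime $p$ is a Sophie Germain prime if $2p+1$ is also prime. $A_n$ is the alternating group of degree $n$. For a finite insoluble group $G$ with soluble radical $R(G)$ (the largest soluble normal subgroup), the soluble graph $\Gamma_{\mathcal{S}}(G)$ has vertex set $G \setminus R(G)$, with distinct vertices $x,y$ adjacent if and only if the subgroup $\langle x,y\rangle$ is soluble. Its diameter is denoted $\delta_{\mathcal{S}}(G)$ (with $\delta_{\mathcal{S}}(G)=\infty$ if the graph is disconnected). *)

(* Defs.v *)
From mathcomp Require Import all_boot all_fingroup all_solvable.

Set Implicit Arguments.
Unset Strict Implicit.
Unset Printing Implicit Defensive.

Definition sophie_germain (p : nat) : bool := prime p && prime (2 * p + 1).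

Section Diameter.

Variables (T : finType) (e : rel T).
Implicit Types x y : T.

Definition walk (n : nat) x y : bool :=
  [exists p : n.-tuple T, path e x p && (last x p == y)].

(* A shortest walk repeats no vertex, so its length is less than #|T|: this is
   the least n such that walk n x y when y is reachable from x (see gdistP).
   It is the junk value #|T| otherwise. *)
Definition gdist x y : nat := find (fun n => walk n x y) (iota 0 #|T|).

(* None stands for infinity. *)
Definition diameter : option nat :=
  if [forall x, forall y, connect e x y]
  then Some (\max_(x : T) \max_(y : T) gdist x y) else None.

Lemma walkP n x y :
  reflect (exists p, [/\ size p = n, path e x p & last x p = y]) (walk n x y).
Proof.
apply: (iffP existsP) => [[p /andP[xp /eqP <-]] | [p [szp xp <-]]].
  by exists p; rewrite size_tuple.
have /eqP szp' := szp.
by exists (Tuple szp'); rewrite /= xp eqxx.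
Qed.

Lemma gdistP x y : connect e x y ->
  walk (gdist x y) x y /\ (forall n, walk n x y -> gdist x y <= n).
Proof.
case/connectP=> p0 xp0 y_last.
have [n lt_n wn] : exists2 n, n < #|T| & walk n x y.
  case/shortenP: xp0 y_last => p xp up _ ->; exists (size p).
    by move/card_uniqP: up => /= <-; apply: max_card.
  by apply/walkP; exists p.
have hasw : has (fun k => walk k x y) (iota 0 #|T|).
  by apply/hasP; exists n; rewrite ?mem_iota.
have lt_d : gdist x y < #|T| by rewrite -[X in _ < X](size_iota 0) -has_find.
split=> [|m wm].
  by have := nth_find 0 hasw; rewrite -/(gdist x y) nth_iota.
rewrite leqNgt; apply/negP => lt_m.
have := before_find 0 lt_m; rewrite nth_iota ?(ltn_trans lt_m) //.
by rewrite add0n wm.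
Qed.

End Diameter.

Section SolubleGraph.

Local Open Scope group_scope.

Variable gT : finGroupType.
Implicit Types G H K : {group gT}.

(* The largest soluble normal subgroup, see sol_radical_normal, sol_radical_sol and
   sol_radical_max. *)
Definition sol_radical G : {group gT} :=
  (\prod_(H : {group gT} | (H <| G) && solvable H) H)%G.

Lemma sol_radical_spec G : (sol_radical G <| G) && solvable (sol_radical G).
Proof.
rewrite /sol_radical; elim/big_ind: _ => //.
  by rewrite normal1 solvable1.
move=> H K /andP[nHG solH] /andP[nKG solK]; rewrite normalY //=.
have [sHG nHG'] := andP nHG; have [sKG _] := andP nKG.
have nHK : K \subset 'N(H) by apply: subset_trans sKG nHG'.
rewrite (@series_sol _ _ H); last first.
  by rewrite /normal joing_subl join_subG normG.
by rewrite solH /= quotientYidl // quotient_sol.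
Qed.

Lemma sol_radical_normal G : sol_radical G <| G.
Proof. by case/andP: (sol_radical_spec G). Qed.

Lemma sol_radical_sol G : solvable (sol_radical G).
Proof. by case/andP: (sol_radical_spec G). Qed.

Lemma sol_radical_max G H : H <| G -> solvable H -> H \subset sol_radical G.
Proof.
move=> nHG solH; rewrite /sol_radical (bigD1 H) ?nHG //=.
exact: joing_subl.
Qed.

Definition sol_vertex G : finType := {x : gT | x \in G :\: sol_radical G}.

Definition sol_adj G : rel (sol_vertex G) :=
  fun x y => (x != y) && solvable <<[set val x; val y]>>.

Definition sol_diameter G : option nat := diameter (@sol_adj G).

End SolubleGraph.

(* Main.v *)
Require Import Defs.
From mathcomp Require Import all_boot all_fingroup all_solvable.
From mathcomp Require Import zify.

(* Let q = 2p + 1 and work in Alt_q; all cycles below are in the symmetric group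
   of degree q, and P, Q denote subgroups of order p.

   Upper bound. Two involutions generate a dihedral group, so it is enough to
   join every nontrivial x to an even involution in at most two steps. If some
   power s of x has odd prime order r <> q, then s is inverted by an even
   involution: reflect every cycle of s; if this is odd then the number of
   r-cycles is odd, so s has at least two fixed points, and multiplying by a
   transposition of fixed points corrects the sign. If x is a q-cycle, then the
   normaliser of <x> has order q(q - 1) (Sylow and Wilson), hence contains an
   element of order p, to which the previous case applies.

   Lower bound. By Galois, a soluble group containing a q-cycle x normalises <x>,
   and the normaliser of <x> in Alt_q has order pq. Hence two q-cycles x and y are
   at distance at least 4 if no P normalising X = <x> and Q normalising Y = <y>
   generate a soluble group. For fixed X the number of groups Y violating this
   is less than the number (q - 2)! of all candidates, since for P normalising
   X and <P, Q> soluble one of the following holds.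
   (A) Q centralises P: at most 2p^2 such Q.
   (B) P and Q fix the same point and preserve a system of p blocks of size 2
       on the other points; then Q = P^k with k fixing every block: at most
       q 2^p such Q.
   (C) P and Q normalise a common subgroup of order q: at most p(p - 1)q such Q.
   This comes from the orbits of a minimal normal subgroup of <P, Q>; a
   primitive action on p + 1 points is excluded because p + 1 is not a power of
   2, as otherwise 3 would divide p or 2p + 1. *)

Set Implicit Arguments.
Unset Strict Implicit.
Unset Printing Implicit Defensive.

Local Open Scope group_scope.

(** * Reflections of the cycles of a permutation *)

Lemma odd_prime_geq5 p : 5 <= p -> prime p -> odd p.
Proof. by move=> p5 /even_prime[p2|//]; rewrite p2 in p5. Qed.

Section Reflection.

Variable T : finType.
Implicit Types (s t : {perm T}) (x y : T).

(** Induction on the number of moved points: multiplying by the transposition of [x] and [t x] gives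
    an involution [u] that fixes both and agrees with [t] elsewhere. *)
Lemma odd_perm_involution t : involutive t ->
  odd_perm t = odd (#|[set x | t x != x]|./2).
Proof.
move=> tK; have [n] := ubnP #|[set x | t x != x]|.
elim: n t tK => // n IHn t tK le_n.
have [t0|[x]] := set_0Vmem [set x | t x != x].
  rewrite t0 cards0 (_ : t = 1) ?odd_perm1 //.
  apply/permP=> y; rewrite perm1; apply/eqP.
  by apply: contraFT (in_set0 y) => ty; rewrite -t0 inE.
rewrite inE => tx.
pose u := tperm x (t x) * t.
have uE y : u y = if (y == x) || (y == t x) then y else t y.
  rewrite permM; case: tpermP => [->|->|/eqP/negPf-> /eqP/negPf->] //.
    by rewrite eqxx tK.
  by rewrite eqxx orbT.
have uK : involutive u.
  move=> y; rewrite [u y]uE; case: ifP => [yx|nyx]; first by rewrite uE yx.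
  rewrite uE tK -(inj_eq (@perm_inj _ t)) tK (inj_eq (@perm_inj _ t)) orbC nyx //.
have def_t : t = tperm x (t x) * u by rewrite mulgA tperm2 mul1g.
have mvE : [set y | t y != y] = x |: (t x |: [set y | u y != y]).
  apply/setP=> y; rewrite !inE uE; have [->|nyx] := eqVneq y x; first by rewrite tx.
  have [->|nytx] := eqVneq y (t x); last by [].
  by rewrite tK eq_sym tx.
have cE : #|[set y | t y != y]| = #|[set y | u y != y]|.+2.
  by rewrite mvE !cardsU1 !inE !uE !eqxx ?orbT /= negb_or eq_sym tx eqxx.
have ltn : #|[set y | u y != y]| < n by move: le_n; rewrite cE; lia.
by rewrite cE def_t odd_mul_tperm eq_sym tx (IHn u uK ltn) /=.
Qed.

(** Each cycle is reflected in its canonical root r: s^n r goes to s^(-n) r, and [findex] supplies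
    one such n. *)
Definition reflect_cycles s x := (s ^- findex s (froot s x) x) (froot s x).

Lemma expg_froot s x : x = (s ^+ findex s (froot s x) x) (froot s x).
Proof.
rewrite permX iter_findex // fconnect_sym; last exact: perm_inj.
exact: connect_root.
Qed.

Lemma froot_expg s n x : froot s ((s ^+ n) x) = froot s x.
Proof.
apply/eqP; rewrite root_connect; last exact/fconnect_sym/perm_inj.
rewrite fconnect_sym; last exact: perm_inj.
by rewrite permX fconnect_iter.
Qed.

(** The exponent chosen by [findex] may differ from [n], but the image is the same: apply s^(-n-m)
    to s^n x = s^m x. *)
Lemma reflect_cyclesE s n x : froot s x = x -> reflect_cycles s ((s ^+ n) x) = (s ^- n) x.
Proof.
move=> rx; rewrite /reflect_cycles froot_expg rx; set m := findex _ _ _.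
have : (s ^+ n) x = (s ^+ m) x.
  by have := expg_froot s ((s ^+ n) x); rewrite froot_expg rx.
have mulX k l : s ^+ k * s ^- (l + k) = s ^- l by rewrite expgD invMg mulKVg.
by move/(congr1 (s ^- (n + m))); rewrite -!permM mulX addnC mulX => ->.
Qed.

Lemma froot_id s x : froot s (froot s x) = froot s x.
Proof. by apply: root_root; apply/fconnect_sym/perm_inj. Qed.

Lemma reflect_cyclesK s : involutive (reflect_cycles s).
Proof.
move=> x; rewrite [in LHS](expg_froot s x); set n := findex _ _ _.
rewrite reflect_cyclesE ?froot_id //.
(* [reflect_cyclesE] needs a natural exponent, so the inverse is rewritten as a power. *)
have -> : s ^- n = s ^+ (#[s].-1 * n) by rewrite expgM -invg_expg expVgn.
rewrite reflect_cyclesE ?froot_id // expgM -invg_expg expVgn invgK.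
by rewrite -(expg_froot s x).
Qed.

Definition reflect_perm s : {perm T} := perm (can_inj (reflect_cyclesK s)).

Lemma reflect_permJ s : s ^ reflect_perm s = s^-1.
Proof.
apply/permP=> y; rewrite -[y](reflect_cyclesK s); set x := reflect_cycles s y.
rewrite -{1}[reflect_cycles s x](permE (can_inj (reflect_cyclesK s))) permJ permE.
rewrite (expg_froot s x); set n := findex _ _ _; rewrite -permM -expgSr.
by rewrite !reflect_cyclesE ?froot_id // expgS invMg permM.
Qed.

Lemma reflect_permK s : involutive (reflect_perm s).
Proof. by move=> x; rewrite !permE reflect_cyclesK. Qed.

(** If s^n r is fixed, r being the root, then s^(2n) r = r, and 2 is invertible modulo the odd order
    of [s]. So each cycle has exactly one fixed point. *)
Lemma reflect_perm_fix s x : odd #[s] -> (reflect_perm s x == x) = (froot s x == x).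
Proof.
move=> odd_s; rewrite permE; apply/eqP/eqP=> [|rx]; last first.
  by rewrite -{1}[x]perm1 -(expg0 s) reflect_cyclesE // expg0 invg1 perm1.
rewrite {1 2}(expg_froot s x); set n := findex _ _ _; set r := froot s x.
rewrite reflect_cyclesE ?froot_id // => /(congr1 (s ^+ n)).
rewrite -!permM mulVg -expgD perm1 => rE.
rewrite [RHS](expg_froot s x) -/n -/r.
have -> : s ^+ n = s ^+ (n + n) ^+ (#[s]./2.+1).
  rewrite -expgM; apply/eqP; rewrite eq_expg_mod_order.
  have -> : ((n + n) * #[s]./2.+1 = n + n * #[s])%N.
    by have := odd_double_half #[s]; rewrite odd_s; lia.
  by rewrite addnC modnMDl.
by rewrite permX_fix.
Qed.

(** Every cycle has length 1 or [#[s]]; the witness [m] counts the long ones. *)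
Lemma fcard_prime_order s : prime #[s] ->
  exists2 m, #|[set x | s x == x]| + m * #[s] = #|T|
           & fcard s T = #|[set x | s x == x]| + m.
Proof.
move=> pr_s; set F := [set x | s x == x].
have clF : fclosed s F.
  move=> x _ /eqP <-; rewrite !inE; apply/eqP/eqP=> [sx|/perm_inj //].
  by rewrite !sx.
have clF' : fclosed s [predC F].
  by move=> x y xy; rewrite !inE; have := clF x y xy; rewrite !inE => ->.
have ordE x : (fingraph.order s x == 1%N) || (fingraph.order s x == #[s]).
  have -> : fingraph.order s x = #|<[s]> : 'C_<[s]>[x | 'P]|.
    rewrite -card_orbit -porbitE; apply: eq_card => y; rewrite inE.
    apply/idP/porbitP=> [/iter_findex <-|[i ->]]; last by rewrite permX fconnect_iter.
    by exists (findex s x y); rewrite permX.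
  by have [_] := primeP pr_s; apply; apply: dvdn_indexg.
have ord1 x : (fingraph.order s x == 1%N) = (x \in F).
  rewrite inE; apply/eqP/eqP=> [o1 | sx].
    by have := iter_order (@perm_inj _ s) x; rewrite o1.
  apply/eqP; rewrite eqn_leq fingraph.order_gt0 andbT -[1%N]/(size [:: x]).
  by rewrite order_le_cycle //= ?sx ?eqxx ?inE ?eqxx.
have h1 : (fcard s F * 1)%N = #|F|.
  by apply: fcard_order_set clF; [apply: perm_inj | apply/subsetP=> x; rewrite -ord1].
have h2 : (fcard s [predC F] * #[s])%N = #|[predC F]|.
  apply: fcard_order_set clF'; [apply: perm_inj | apply/subsetP=> x].
  by rewrite inE -ord1 => nFx; have := ordE x; rewrite (negPf nFx).
exists (fcard s [predC F]); first by rewrite h2 cardC.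
by rewrite (n_compC F) -h1 muln1.
Qed.

End Reflection.

Lemma even_inverter (T : finType) (s : {perm T}) :
    prime #|T| -> odd #|T| -> prime #[s] -> odd #[s] -> #[s] != #|T| ->
  exists t : {perm T}, [/\ t \in 'Alt_T, #[t] = 2 & s ^ t = s^-1].
Proof.
move=> pr_T odd_T pr_s odd_s neq_sT.
have ord2 t : s ^ t = s^-1 -> t * t = 1 -> #[t] = 2.
  move=> st tt; apply/eqP; rewrite eqn_leq dvdn_leq //=;
    last by rewrite order_dvdn expgS expg1 tt.
  rewrite ltn_neqAle order_gt0 eq_sym order_eq1 andbT; apply: contraTneq odd_s => t1.
  have s2 : s ^+ 2 = 1 by rewrite expgS expg1 -{2}[s]conjg1 -t1 st mulgV.
  have := prime_gt1 pr_s; have := @dvdn_leq #[s] 2 isT.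
  by rewrite order_dvdn s2 eqxx => /(_ isT); case: #[s] => [|[|[|]]].
set t0 := reflect_perm s.
have t0K : t0 * t0 = 1 by apply/permP=> x; rewrite permM reflect_permK perm1.
have t0J : s ^ t0 = s^-1 := reflect_permJ s.
have [ev|/negPn od] := boolP (~~ odd_perm t0).
  by exists t0; split; rewrite ?Alt_even ?ord2.
have [m] := fcard_prime_order pr_s; set F := [set x | s x == x] => cF fcF.
have mvE : [set x | t0 x != x] = ~: [set x in froots s].
  by apply/setP=> x; rewrite !inE reflect_perm_fix.
have cmv : #|[set x | t0 x != x]| = (#|T| - fcard s T)%N.
  rewrite mvE cardsCs setCK cardsE; congr (_ - _)%N.
  by apply: eq_card => x; rewrite !inE andbT.
(* The number of fixed points is nonzero, as [#|T|] is a prime other than [#[s]]. It is even because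
   each long cycle gives [#[s]./2] transpositions of the odd [t0], which makes [m] odd. *)
have [u [v [uF vF uv]]] : exists u v, [/\ u \in F, v \in F & u != v].
  have F_neq0 : #|F| != 0%N.
    apply: contraNneq neq_sT => F0; move: cF; rewrite F0 add0n => cF.
    by rewrite -dvdn_prime2 // -cF dvdn_mull.
  have m_odd : odd m.
    move: od; rewrite odd_perm_involution ?cmv; last exact: reflect_permK.
    rewrite fcF -cF subnDl.
    have -> : (m * #[s] - m)%N = (m * #[s]./2).*2.
      have := odd_double_half #[s]; rewrite odd_s; move: #[s]./2 => h <-.
      by rewrite -!muln2; nia.
    by rewrite doubleK oddM => /andP[].
  have F_even : ~~ odd #|F|.
    by move: odd_T; rewrite -cF oddD oddM m_odd odd_s addbT.
  have /card_gt1P[u [v]] : 1 < #|F| by case: #|F| F_neq0 F_even => [|[|]].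
  by case=> *; exists u, v.
have froot_fix x : x \in F -> t0 x = x.
  rewrite inE => /eqP sx; apply/eqP; rewrite reflect_perm_fix //.
  have /iter_findex <- := connect_root (frel s) x.
  by rewrite -permX permX_fix.
have tperm_comm (w : {perm T}) : w u = u -> w v = v -> commute w (tperm u v).
  by move=> wu wv; apply/commute_sym/commgP/conjg_fixP; rewrite tpermJ wu wv.
have c_t0 := tperm_comm t0 (froot_fix _ uF) (froot_fix _ vF).
have c_s : commute s (tperm u v).
  by move: uF vF; rewrite !inE => /eqP su /eqP sv; apply: tperm_comm.
have tJ : s ^ (t0 * tperm u v) = s^-1.
  by rewrite conjgM t0J conjVg; congr _^-1; apply/conjg_fixP/commgP.
exists (t0 * tperm u v); split=> //; last first.
  apply: ord2 => //; have := expgMn 2 c_t0.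
  by rewrite !expgS !expg0 !mulg1 t0K tperm2 mul1g.
by rewrite Alt_even odd_permM odd_tperm uv od.
Qed.

(** * Subgroups of prime order acting transitively *)

Lemma dvdn_card_norm_cyclic (gT : finGroupType) (G X : {group gT}) :
  cyclic X -> #|'N_G(X)| %| #|'C_G(X)| * totient #|X|.
Proof.
move=> cycX; rewrite -(LagrangeI 'N_G(X) 'C(X)) -setIA (setIidPr (cent_sub X)).
rewrite dvdn_pmul2l // -(card_Aut_cyclic cycX).
have -> : #|'N_G(X) : 'C(X)| = #|conj_aut X @* 'N_G(X)|.
  by rewrite card_morphim ker_conj_aut (setIidPr (subsetIr _ _)).
exact/cardSg/Aut_conj_aut.
Qed.

Section PrimeDegree.

Variable T : finType.
Hypothesis pr_T : prime #|T|.
Implicit Types (X Y P Q : {group {perm T}}) (s t : {perm T}) (a b : T).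

Local Notation q := #|T|.
Local Notation S := [set: {perm T}].

Let q_gt0 : 0 < q := prime_gt0 pr_T.

Lemma card_setTperm : #|S| = q`!.
Proof. by rewrite -card_Sym. Qed.

Lemma prime_ndvd_fact r : prime r -> ~~ (r %| (r.-1)`!).
Proof.
move=> pr_r; have := pr_r; rewrite Wilson ?prime_gt1 // => dv.
by apply/negP=> /dvdn_addr - /(_ 1%N); rewrite addn1 dv dvdn1 => /esym/eqP r1; rewrite r1 in pr_r.
Qed.

Lemma fact_prime_degree : q`! = (q * (q.-1)`!)%N.
Proof. by rewrite -{1}(prednK q_gt0) factS prednK. Qed.

Lemma part_fact_prime_degree : ((q`!)`_q)%N = q.
Proof.
rewrite p_part fact_prime_degree lognM ?fact_gt0 // logn_prime // eqxx.
by rewrite lognE (negPf (prime_ndvd_fact pr_T)) !andbF.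
Qed.

Lemma Sylow_prime_degree X : #|X| = q -> q.-Sylow(S) X.
Proof.
by move=> oX; rewrite pHallE subsetT /= card_setTperm oX part_fact_prime_degree.
Qed.

Lemma card_pgroup_prime_degree X : q.-group X -> X :!=: 1 -> #|X| = q.
Proof.
move=> qX ntX; have [Y sylY sXY] := Sylow_superset (subsetT X) qX.
have oY : #|Y| = q by rewrite (card_Hall sylY) card_setTperm part_fact_prime_degree.
have := cardSg sXY; rewrite oY; case/primeP: pr_T => _ /[apply] /orP[|/eqP //].
by rewrite -trivg_card1 (negPf ntX).
Qed.

Lemma prime_degree_conj X Y : #|X| = q -> #|Y| = q -> exists t, Y :=: X :^ t.
Proof.
move=> oX oY.
by have [t _ ->] := Sylow_trans (Sylow_prime_degree oX) (Sylow_prime_degree oY); exists t.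
Qed.

Lemma prime_degree_cycle X : #|X| = q -> exists2 x, X :=: <[x]> & #[x] = q.
Proof.
move=> oX; have /cyclicP[x defX] : cyclic X by rewrite prime_cyclic ?oX.
by exists x; rewrite // orderE -defX.
Qed.

Lemma prime_degree_trans X : #|X| = q -> [transitive X, on setT | 'P].
Proof.
by move=> oX; have [x -> ox] := prime_degree_cycle oX; apply: perm_prime_atrans.
Qed.

Lemma cent_trans_fix1 X h a : [transitive X, on setT | 'P] ->
  h \in 'C(X) -> h a = a -> h = 1.
Proof.
move=> trX /centP cXh ha; apply/permP=> b; rewrite perm1.
have [x Xx ->] := atransP2 trX (in_setT a) (in_setT b).
by rewrite /aperm -permM -(cXh x Xx) permM ha.
Qed.

Lemma cent_prime_degree X : #|X| = q -> 'C(X) = X.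
Proof.
move=> oX; have trX := prime_degree_trans oX; apply/eqP.
have abX : abelian X by rewrite cyclic_abelian // prime_cyclic ?oX.
rewrite eqEsubset [X \subset _]abX andbT; apply/subsetP=> h cXh.
have /card_gt0P[a _] : 0 < q by exact: prime_gt0.
have [x Xx hx] := atransP2 trX (in_setT a) (in_setT (h a)).
suff /eqP : h * x^-1 = 1 by rewrite -eq_mulgV1 => /eqP->.
apply: (cent_trans_fix1 (a := a) trX); last by rewrite permM hx /aperm permK.
by rewrite groupM ?groupV // (subsetP abX).
Qed.

(** By regularity only one [x] in [X] takes [a] to [b], and its conjugate by [h] does so too. Hence
    [h] centralises [x], which generates [X], and it fixes a point. *)
Lemma norm_prime_degree_fix2 X h a b : #|X| = q ->
  h \in 'N(X) -> a != b -> h a = a -> h b = b -> h = 1.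
Proof.
move=> oX nXh neq_ab ha hb; have trX := prime_degree_trans oX.
have [x Xx hx] := atransP2 trX (in_setT a) (in_setT b).
have Xxh : x ^ h \in X by rewrite memJ_norm.
have abX : abelian X by rewrite cyclic_abelian // prime_cyclic ?oX.
have xhx : x ^ h * x^-1 = 1.
  apply: (cent_trans_fix1 (a := a) trX).
    by rewrite (subsetP abX) // groupM ?groupV.
  by rewrite permM -{1}ha permJ -[x a]/(aperm a x) -hx hb hx /aperm permK.
have gen_x : X :=: <[x]>.
  apply/eqP; rewrite eq_sym eqEcard cycle_subG Xx oX /= -orderE.
  have : #[x] %| q by rewrite -oX order_dvdG.
  case/primeP: pr_T => _ /[apply] /predU1P[/eqP|/eqP->] //.
  by rewrite order_eq1 => /eqP x1; rewrite hx x1 act1 eqxx in neq_ab.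
apply: (cent_trans_fix1 (a := a) trX) => //.
rewrite gen_x cent_cycle; apply/cent1P/commute_sym/commgP/conjg_fixP.
by apply/eqP; rewrite eq_mulgV1 xhx.
Qed.

(** The order is qk with k at most q - 1, as [X] is its own centraliser. The number of Sylow
    q-subgroups times k is (q - 1)!, so Sylow's congruence and Wilson's theorem give k = -1 modulo
    q. *)
Lemma card_norm_prime_degree X : #|X| = q -> #|'N(X)| = (q * q.-1)%N.
Proof.
move=> oX; have := card_Syl (Sylow_prime_degree oX); rewrite setTI => cS.
have sXN : #|X| %| #|'N(X)| by rewrite cardSg ?normG.
have [k defk] := dvdnP sXN; rewrite oX in defk.
have k_gt0 : 0 < k by move: (cardG_gt0 'N(X)); rewrite defk muln_gt0 => /andP[].
have le_k : k <= q.-1.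
  have := @dvdn_card_norm_cyclic _ [group of S] X; rewrite prime_cyclic ?oX //.
  rewrite !setTI cent_prime_degree // oX totient_prime // => /(_ isT).
  rewrite defk mulnC dvdn_pmul2l ?prime_gt0 //; apply: dvdn_leq.
  by have := prime_gt1 pr_T; lia.
have iN : (#|'Syl_q(S)| * k = (q.-1)`!)%N.
  have := Lagrange (subsetT 'N(X)); rewrite -cS card_setTperm defk.
  rewrite fact_prime_degree => e.
  apply/eqP; rewrite -(eqn_pmul2l q_gt0) -e; apply/eqP.
  by rewrite mulnCA mulnC [(q * k)%N]mulnC.
have := pr_T; rewrite Wilson ?prime_gt1 // -iN => dv.
have e1 : (#|'Syl_q(S)| * k + 1) %% q = (k + 1) %% q.
  by rewrite -modnDml -modnMml (card_Syl_mod S pr_T) mul1n modnDml.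
have /dvdn_leq - /(_ isT) le_q : q %| k.+1.
  by rewrite /dvdn -[k.+1]addn1 -e1 addn1 -/(dvdn _ _).
by rewrite defk mulnC; congr (_ * _)%N; lia.
Qed.

End PrimeDegree.

(** * Elements close to an involution *)

Section TwoGenerators.

Variable gT : finGroupType.
Implicit Types x y s t : gT.

Lemma solvable_norm_cycle s t : t \in 'N(<[s]>) -> solvable <<[set s; t]>>.
Proof.
move=> nst; have nst' : <[t]> \subset 'N(<[s]>) by rewrite cycle_subG.
have -> : <<[set s; t]>> = <[s]> <*> <[t]>.
  by rewrite /cycle joing_idl joing_idr.
rewrite (@series_sol _ _ <[s]>); last by rewrite /normal joing_subl join_subG normG.
rewrite abelian_sol ?cycle_abelian //= quotientYidl // quotient_sol //.
by rewrite abelian_sol ?cycle_abelian.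
Qed.

(** The involution [s] inverts [s * t], so it normalises the cyclic group generated by this
    product. *)
Lemma solvable_involutions s t : #[s] = 2 -> #[t] = 2 -> solvable <<[set s; t]>>.
Proof.
move=> os ot; have ss : s^-1 = s by apply/eqP; rewrite eq_invg_mul -expg2 -os expg_order.
have tt : t^-1 = t by apply/eqP; rewrite eq_invg_mul -expg2 -ot expg_order.
have sol : solvable <<[set s * t; s]>>.
  apply: solvable_norm_cycle; rewrite inE -cycleJ cycle_subG.
  by rewrite conjgE !mulgA mulVg mul1g -{1}tt -{1}ss -invMg groupV cycle_id.
apply: solvableS sol; rewrite gen_subG subUset !sub1set; apply/andP; split.
  by rewrite mem_gen ?set22.
suff : s^-1 * (s * t) \in <<[set s * t; s]>> by rewrite mulKg.
by rewrite groupM ?groupV ?mem_gen ?set21 ?set22.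
Qed.

Lemma solvable_powers x n : solvable <<[set x; x ^+ n]>>.
Proof.
by apply: solvable_norm_cycle; rewrite (subsetP (normG _)) ?mem_cycle.
Qed.

Lemma order_prime_power x r : prime r -> r %| #[x] -> exists n, #[x ^+ n] = r.
Proof.
move=> pr_r dv; exists (#[x] %/ r); rewrite orderXdiv ?dvdn_div //.
by rewrite divnA // mulKn.
Qed.

End TwoGenerators.

Section NearInvolution.

Variable T : finType.
Implicit Types (x y s t : {perm T}).

Lemma odd_order_Alt x : odd #[x] -> x \in 'Alt_T.
Proof.
move=> odd_x; rewrite Alt_even.
(* An element of odd order is a square. *)
have -> : x = x ^+ #[x]./2.+1 * x ^+ #[x]./2.+1.
  rewrite -expgD; have -> : (#[x]./2.+1 + #[x]./2.+1 = 1 + #[x])%N.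
    by have := odd_double_half #[x]; rewrite odd_x; lia.
  by rewrite expgD expg_order mulg1.
by rewrite odd_permM addbb.
Qed.

Lemma near_involution p x : prime #|T| -> odd #|T| -> prime p -> odd p -> p %| #|T|.-1 ->
    x \in 'Alt_T -> x != 1 ->
  exists z t, [/\ z \in 'Alt_T, z != 1, t \in 'Alt_T, #[t] = 2
    & solvable <<[set x; z]>> && solvable <<[set z; t]>>].
Proof.
move=> pr_T odd_T pr_p odd_p dv_p Ax x1.
have inv s : prime #[s] -> odd #[s] -> #[s] != #|T| ->
    exists t, [/\ t \in 'Alt_T, #[t] = 2 & solvable <<[set s; t]>>].
  move=> pr_s odd_s neq_s.
  have [t [At ot st]] := even_inverter pr_T odd_T pr_s odd_s neq_s.
  exists t; split=> //; apply: solvable_norm_cycle.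
  by rewrite inE -cycleJ st cycleV.
have nt s : prime #[s] -> s != 1 by apply: contraTneq => ->; rewrite order1.
(* For even order, [z] is [x] itself and [t] is a power of it. *)
have [odd_x|] := boolP (odd #[x]); last first.
  rewrite -dvdn2 => /(order_prime_power (isT : prime 2)) [n on].
  exists x, (x ^+ n); split=> //; first by rewrite groupX.
  by rewrite solvable_powers -{2}[x]expg1 solvable_powers.
have prod_odd n : n %| #[x] -> odd n by move/dvdn_odd; apply.
(* If a prime r other than [#|T|] divides the order, [z] is a power of order r. *)
have [/pgroupP qx|] := boolP (#|T|.-group <[x]>); last first.
  rewrite /pgroup -orderE /pnat order_gt0 /= => /allPn[r].
  rewrite mem_primes => /and3P[pr_r _ dv_r] neq_r.
  have [n on] := order_prime_power pr_r dv_r.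
  have [|||t [At ot st]] := inv (x ^+ n); rewrite ?on ?prod_odd //.
  by exists (x ^+ n), t; rewrite groupX // nt ?on // solvable_powers.
have dv_q : #|T| %| #[x].
  have := pdiv_prime (n := #[x]); rewrite ltn_neqAle order_gt0 eq_sym order_eq1 x1.
  move=> /(_ isT) pr_d; have := qx _ pr_d (pdiv_dvd _).
  by rewrite inE => /eqP <-; apply: pdiv_dvd.
have [n on] := order_prime_power pr_T dv_q.
pose X := <[x ^+ n]>%G; have oX : #|X| = #|T| by [].
(* [x] commutes with its power [x ^+ n], and [X] is its own centraliser; this makes [x] a generator
   of [X]. *)
have Xx : x \in X.
  by rewrite -(cent_prime_degree pr_T oX) cent_cycle cent1C groupX ?cent1id.
have [z nXz oz] : {z | z \in 'N(X) & #[z] = p}.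
  by apply: Cauchy; rewrite // card_norm_prime_degree // dvdn_mull.
have neq_p : p != #|T|.
  have q_gt1 := prime_gt1 pr_T; rewrite neq_ltn; apply/orP; left.
  have := dvdn_leq _ dv_p; lia.
have [|||t [At ot zt]] := inv z; rewrite ?oz //.
exists z, t; split; rewrite ?nt ?oz //; first by rewrite odd_order_Alt ?oz.
rewrite zt andbT.
apply: solvable_norm_cycle.
suff <- : X :=: <[x]> by [].
by apply/eqP; rewrite eq_sym eqEcard cycle_subG Xx oX dvdn_leq.
Qed.

End NearInvolution.

(** * Soluble transitive actions *)

Section SolvableActions.

Variables (aT : finGroupType) (sT : finType) (to : {action aT &-> sT}).
Implicit Types (H K V W : {group aT}) (Om : {set sT}).

Lemma solvable_chief_over H K : solvable H -> K <| H -> ~~ (H \subset K) ->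
  exists V : {group aT}, [/\ V <| H, K \subset V, ~~ (V \subset K), V^`(1) \subset K
    & exists2 r, prime r & r.-group (V / K)].
Proof.
move=> solH nKH nsHK; have [sKH nKH'] := andP nKH.
have ntHK : H / K != 1 by rewrite -subG1 quotient_sub1.
have [Vb [_ nVb ntVb /is_abelemP[r pr_r abVb]]] :=
  solvable_norm_abelem (quotient_sol K solH) (normal_refl (H / K)) ntHK.
have [V defVb sKV nVH] := inv_quotientN nKH nVb.
have nKV : V \subset 'N(K) by rewrite (subset_trans (normal_sub nVH)).
exists V; split=> //.
- by rewrite -quotient_sub1 // -defVb subG1.
- by rewrite der1_min // -defVb (abelem_abelian abVb).
by exists r => //; rewrite -defVb (abelem_pgroup abVb).
Qed.

(** Modulo the kernel [W] is abelian and transitive, hence regular: point stabilisers act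
    trivially. *)
Lemma card_trans_der1_astab W Om : [transitive W, on Om | to] ->
  W^`(1) \subset 'C(Om | to) -> (#|Om| * #|'C_W(Om | to)|)%N = #|W|.
Proof.
move=> trW sW'C; have [x Omx _] := imsetP trW.
rewrite -(card_orbit_stab to W x) (atransP trW) //; congr (#|Om| * #|pred_of_set _|)%N.
apply/eqP; rewrite eqEsubset setIS ?astabS ?sub1set //= subsetI subsetIl /=.
apply/subsetP=> w /setIP[Ww /astab1P xw]; apply/astabP=> y Omy.
have [v Wv ->] := atransP2 trW Omx Omy.
rewrite -actM commgC actM (astab_act (subsetP sW'C _ (mem_commg Wv Ww))) actM xw //.
by rewrite -(atransP trW _ Omx) mem_orbit ?groupM.
Qed.

(** A form of Galois's theorem on soluble groups of prime degree. The action is primitive, so a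
    normal [V] that acts nontrivially and as an abelian group is transitive, hence regular. *)
Lemma solvable_trans_prime H Om : solvable H -> [transitive H, on Om | to] ->
    prime #|Om| ->
  exists V : {group aT}, [/\ V <| H, 'C_H(Om | to) \subset V,
     V^`(1) \subset 'C_H(Om | to), #|V| = (#|Om| * #|'C_H(Om | to)|)%N
   & forall y, y \in H -> y ^+ #|Om| = 1 -> y \in V].
Proof.
move=> solH trH pr_Om; set K := 'C_H(Om | to)%G.
have actH := atrans_acts trH.
have nKH : K <| H.
  by rewrite /normal subsetIl normsI ?normG // (subset_trans actH) ?astab_norm.
have [sKH nKH'] := andP nKH.
have [x Omx _] := imsetP trH.
have nsHK : ~~ (H \subset K).
  rewrite subsetI subxx /=; apply/negP => sHC; have := trH.
  rewrite atrans_acts_card => /andP[_ /eqP].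
  have : orbit to H x = [set x].
    apply/orbit1P/afixP=> h Hh; exact: astab_act (subsetP sHC _ Hh) Omx.
  by rewrite (atransP trH _ Omx) => Om1; rewrite Om1 cards1 in pr_Om.
have [V [nVH sKV nsVK dV _]] := solvable_chief_over solH nKH nsHK.
have sVH := normal_sub nVH.
have primH : [primitive H, on Om | to].
  rewrite (trans_prim_astab Omx) //; apply/maximal_eqP; split=> [|W sCW sWH].
    exact: subsetIl.
  have dvW : #|H : W| %| #|Om|.
    rewrite -(atransP trH _ Omx) card_orbit -(Lagrange_index sWH sCW).
    by rewrite dvdn_mulr.
  case/primeP: (pr_Om) => _ /(_ _ dvW) /orP[/eqP iW | /eqP iW].
    by right; apply/eqP; rewrite eqEsubset sWH -indexg_eq1 iW /=.
  left; apply/eqP; rewrite eq_sym eqEcard sCW.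
  have := Lagrange sWH; have := Lagrange (subsetIl H 'C[x | to]).
  rewrite -card_orbit (atransP trH _ Omx) iW => <- /eqP.
  by rewrite eqn_pmul2r ?prime_gt0 // => /eqP cWC; rewrite -cWC leqnn.
have [|trV] := prim_trans_norm primH nVH; first by rewrite (negPf nsVK).
have stabE (W : {group aT}) : W \subset H -> K \subset W -> 'C_W(Om | to) = K.
  by move=> sWH sKW; rewrite -(setIidPl sWH) -setIA (setIidPr sKW).
(* By regularity, a subgroup of [H] above [V] that is abelian modulo [K] cannot exceed [V]; this is
   what traps [y]. *)
have cW (W : {group aT}) : V \subset W -> W \subset H -> W^`(1) \subset K ->
    #|W| = (#|Om| * #|K|)%N.
  move=> sVW sWH sW'K; rewrite -(stabE W) ?(subset_trans sKV) //.
  rewrite card_trans_der1_astab ?(subset_trans sW'K) ?subsetIr //.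
  by rewrite (atrans_supgroup sVW trV) (subset_trans sWH).
exists V; split=> //; first exact: cW.
move=> y Hy yp; have nKy : y \in 'N(K) by rewrite (subsetP nKH').
have nKV := subset_trans sVH nKH'.
have [//|nVy] := boolP (y \in V).
have oVb : #|V / K| = #|Om|.
  by rewrite card_quotient // -divgS // cW // mulnK.
have nyVb : coset K y \notin V / K.
  apply: contra nVy => Vb; have nKVn : K <| V by rewrite /normal sKV.
  by rewrite -(quotientGK nKVn); apply/morphpreP.
have sWN : <<y |: V>> \subset 'N(K) by rewrite gen_subG subUset sub1set nKy.
(* If [y] lay outside [V], this quotient would have the square of a prime as its order. *)
have abW : abelian (<<y |: V>> / K).
  have -> : <<y |: V>> / K = (V / K) <*> <[coset K y]>.
    by rewrite quotient_gen ?subUset ?sub1set ?nKy // quotientU quotient_set1 //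
      setUC /cycle joing_idr.
  have oy : #[coset K y] = #|Om|.
    have : #[coset K y] %| #|Om| by rewrite order_dvdn -morphX ?yp ?morph1.
    case/primeP: (pr_Om) => _ /[apply] /orP[/eqP o1|/eqP //].
    by move/eqP: o1 nyVb; rewrite order_eq1 => /eqP->; rewrite group1.
  have tiVy : (V / K) :&: <[coset K y]> = 1.
    rewrite setIC prime_TIg ?cycle_subG // -orderE oy //.
  have nVyb : <[coset K y]> \subset 'N(V / K).
    by rewrite cycle_subG (subsetP (quotient_norms _ (normal_norm nVH))) ?mem_quotient.
  apply: (@card_p2group_abelian _ #|Om|) => //.
  by rewrite /= norm_joinEr // TI_cardMg // oVb -orderE oy expnS expn1.
have := cW <<y |: V>>%G (subset_trans (subsetUr _ _) (subset_gen _)).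
rewrite gen_subG subUset sub1set Hy sVH der1_min // => /(_ isT isT).
rewrite -(cW V) // => /esym/eqP; rewrite eq_sym => cE.
have : V :=: <<y |: V>>.
  by apply/eqP; rewrite eqEcard (eqP cE) leqnn (subset_trans (subsetUr _ _) (subset_gen _)).
by move=> defV; case/negP: nVy; rewrite defV mem_gen ?setU11.
Qed.

End SolvableActions.

(** * Soluble groups generated by two subgroups of order p *)

Lemma succ_sophie_germain_not_prime_power p r m :
  5 <= p -> prime p -> prime (2 * p + 1) -> prime r -> (r ^ m)%N <> p.+1.
Proof.
move=> p5 pr_p pr_q pr_r rm.
have odd_p := odd_prime_geq5 p5 pr_p.
have r2 : r = 2.
  have : (2 %| r ^ m)%N by rewrite rm dvdn2 /= odd_p.
  by rewrite Euclid_dvdX // => /andP[]; rewrite dvdn_prime2 // => /eqP.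
have mod3 : ((2 ^ m %% 3 == 1) || (2 ^ m %% 3 == 2))%N.
  by elim: (m) => // n; rewrite expnS -modnMmr => /orP[] /eqP->.
have n3 n : prime n -> 5 <= n -> ~~ (3 %| n).
  by move=> pr_n n5; rewrite dvdn_prime2 // neq_ltn (leq_trans _ n5).
have := n3 p pr_p p5; have := n3 _ pr_q; rewrite /dvdn => /(_ ltac:(lia)).
by move: mod3; rewrite -r2 rm; lia.
Qed.

Lemma mod1_below p n : 1 < n -> n < 2 * p + 1 -> n = 1 %[mod p] -> n = p.+1.
Proof.
move=> n1 np /eqP; rewrite eqn_mod_dvd ?(ltnW n1) // => /dvdnP[k].
by case: k => [|[|k]]; rewrite ?mulSn; lia.
Qed.

Lemma expn_below p m : 5 <= p -> 1 < p ^ m -> p ^ m <= 2 * p + 1 -> (p ^ m)%N = p.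
Proof.
move=> p5; case: m => [|[|m]]; rewrite ?expn1 // !expnS => _.
have pm : 0 < p ^ m by rewrite expn_gt0 (leq_trans _ p5).
have := leq_mul (leqnn p) (leq_mul p5 pm); lia.
Qed.

Section Blocks.

Variable T : finType.
Implicit Types (V P Q R H K : {group {perm T}}) (a b c x y : T) (B : {set T}).

Lemma orbit_norm V h x : h \in 'N(V) ->
  ('P^*)%act (orbit 'P V x) h = orbit 'P V (h x).
Proof. by move=> nVh; rewrite /= setact_orbit (normP nVh). Qed.

(** [R] permutes the orbits of [V]; having prime order, it either preserves [B] or moves it through
    [#|R|] disjoint images. *)
Lemma norm_blocks R V x : prime #|R| -> R \subset 'N(V) ->
  let B := orbit 'P V x in
  [acts R, on B | 'P] \/
  #|orbit 'P^* R B| = #|R| /\ #|cover (orbit 'P^* R B)| = (#|R| * #|B|)%N.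
Proof.
move=> pr_R nVR B; have := dvdn_orbit 'P^* R B.
case/primeP: pr_R => _ /[apply] /orP[/eqP o1 | /eqP oR].
  left; rewrite -(astab1_set 'P B) sub_astab1; apply/orbit1P; exact: card_orbit1.
right; split=> //.
have orbB A : A \in orbit 'P^* R B -> exists2 y, A = orbit 'P V y & #|A| = #|B|.
  case/orbitP=> h Rh <-; exists (h x); last exact: card_setact.
  by rewrite orbit_norm // (subsetP nVR).
have tI : trivIset (orbit 'P^* R B).
  apply/trivIsetP=> A1 A2 /orbB[y1 -> _] /orbB[y2 -> _].
  apply: contraR; rewrite -setI_eq0 => /set0Pn[z /setIP[]].
  by move=> /orbit_eqP <- /orbit_eqP <-.
rewrite -(eqP tI) (eq_bigr (fun=> #|B|)) => [|A /orbB[] //].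
by rewrite sum_nat_const oR.
Qed.

End Blocks.

Section PrimeOneFixedPoint.

Variables (T : finType) (p : nat).
Hypothesis pr_p : prime p.
Implicit Types (V P Q R H K : {group {perm T}}) (a b c x y : T) (F : {set T}).

Lemma acts_card_mod P a F : #|P| = p -> 'Fix_('P)(P) = [set a] ->
  [acts P, on F | 'P] -> #|F| = (a \in F) %[mod p].
Proof.
move=> oP fixP actF; rewrite (pgroup_fix_mod _ actF) ?/pgroup ?oP ?pnat_id //.
congr (_ %% p); rewrite fixP; case: (boolP (a \in F)) => aF.
  by rewrite (setIidPr _) ?cards1 ?sub1set.
by apply: eq_card0 => y; rewrite !inE; apply: contraNF aF => /andP[yF /eqP <-].
Qed.

Lemma card_orbit_nfix P a x : #|P| = p -> 'Fix_('P)(P) = [set a] -> x != a ->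
  #|orbit 'P P x| = p.
Proof.
move=> oP fixP xa; have := dvdn_orbit 'P P x; rewrite oP.
case/primeP: pr_p => _ /[apply] /orP[/eqP o1 | /eqP //].
by have /orbit1P := card_orbit1 o1; rewrite fixP inE (negPf xa).
Qed.

Hypotheses (p_ge5 : 5 <= p) (cardT : #|T| = (2 * p + 1)%N) (pr_T : prime #|T|).

Lemma acts_orbit_fix P V a : P \subset 'N(V) -> a \in 'Fix_('P)(P) ->
  [acts P, on orbit 'P V a | 'P].
Proof.
move=> nVP /afixP Pa; apply/subsetP=> h Ph; rewrite -(astab1_set 'P).
by apply/astab1P; rewrite orbit_norm ?(subsetP nVP) // [h a]Pa.
Qed.

(** The orbit is [P]-invariant and contains the only fixed point of [P], so its size is 1 modulo
    p. *)
Lemma card_orbit_fix P V a : #|P| = p -> 'Fix_('P)(P) = [set a] -> P \subset 'N(V) ->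
  [\/ orbit 'P V a = [set a], #|orbit 'P V a| = p.+1 | #|orbit 'P V a| = #|T|].
Proof.
move=> oP fixP nVP; have actP : [acts P, on orbit 'P V a | 'P].
  by apply: acts_orbit_fix; rewrite // fixP set11.
have := acts_card_mod oP fixP actP; rewrite orbit_refl.
have : #|orbit 'P V a| <= #|T| := max_card _.
have : 0 < #|orbit 'P V a| by rewrite card_gt0; apply/set0Pn; exists a; apply: orbit_refl.
case: (eqVneq #|orbit 'P V a| 1%N) => [/card_orbit1 | n1]; first by constructor 1.
move=> n0; rewrite leq_eqVlt => /predU1P[|ltT]; first by constructor 3.
constructor 2; apply: mod1_below => //; last by rewrite -cardT.
by rewrite ltn_neqAle eq_sym n1.
Qed.

Lemma prime_power_orbit r V x : prime r -> r.-group V -> exists m, #|orbit 'P V x| = (r ^ m)%N.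
Proof.
move=> pr_r rV; have [|m ->] := @p_natP r #|orbit 'P V x|; last by exists m.
by apply: pnat_dvd rV; apply: dvdn_orbit.
Qed.

Lemma pgroup_norm_prime_degree V r a : prime r -> r.-group V ->
  #|orbit 'P V a| = #|T| -> #|V| = #|T|.
Proof.
move=> pr_r rV oV; have [m] := prime_power_orbit a pr_r rV; rewrite oV => Trm.
have eq_r : #|T| = r.
  have : #|T| %| r ^ m by rewrite -Trm.
  by rewrite Euclid_dvdX // => /andP[]; rewrite dvdn_prime2 // => /eqP.
apply: card_pgroup_prime_degree => //; first by rewrite eq_r.
apply: contra_eq_neq oV => V1.
have /orbit1P -> : a \in 'Fix_('P)(V) by rewrite V1 afix1 inE.
by rewrite cards1 neq_ltn prime_gt1.
Qed.

Lemma no_succ_orbit V r x : prime r -> r.-group V -> #|orbit 'P V x| <> p.+1.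
Proof.
move=> pr_r rV; have [m ->] := prime_power_orbit x pr_r rV.
by apply: succ_sophie_germain_not_prime_power; rewrite // -cardT.
Qed.

(** Unless the elementary abelian normal subgroup [V] has order q, it fixes [a] and [b], and its
    fixed-point set [F] is a single orbit of p + 1 points. A second layer [V1], over the kernel on
    [F], then contradicts [card_orbit_fix]: its orbit of [a] can have neither 1, nor p + 1, nor q
    points. *)
Lemma solvable_pair_fix_neq P Q a b :
    #|P| = p -> 'Fix_('P)(P) = [set a] -> #|Q| = p -> 'Fix_('P)(Q) = [set b] ->
    a != b -> solvable (P <*> Q) ->
  exists U : {group {perm T}}, [/\ #|U| = #|T|, P \subset 'N(U) & Q \subset 'N(U)].
Proof.
move=> oP fixP oQ fixQ neq_ab solH; set H := (P <*> Q)%G.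
have sPH : P \subset H := joing_subl P Q.
have sQH : Q \subset H := joing_subr P Q.
have ntH : H :!=: 1.
  apply: contraTneq pr_p => H1; rewrite -oP.
  by move: sPH; rewrite H1 => /trivgP ->; rewrite cards1.
have [V [_ nVH ntV /is_abelemP[r pr_r /abelem_pgroup rV]]] :=
  solvable_norm_abelem solH (normal_refl H) ntH.
have [sVH nVH'] := andP nVH.
have nVP := subset_trans sPH nVH'; have nVQ := subset_trans sQH nVH'.
have fixV R c : R \subset 'N(V) -> #|R| = p -> 'Fix_('P)(R) = [set c] ->
    c \in 'Fix_('P)(V) \/ #|V| = #|T|.
  move=> nVR oR fixR; case: (card_orbit_fix oR fixR nVR).
  - by move/orbit1P; left.
  - by move/(no_succ_orbit pr_r rV).
  by move/(pgroup_norm_prime_degree pr_r rV); right.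
have [Va|oV] := fixV P a nVP oP fixP; last by exists V.
have [Vb|oV] := fixV Q b nVQ oQ fixQ; last by exists V.
set F := 'Fix_('P)(V) in Va Vb.
have actH : [acts H, on F | 'P] := acts_fix_norm 'P nVH'.
have actP := subset_trans sPH actH.
have F_lt : #|F| < #|T|.
  rewrite ltn_neqAle max_card andbT; apply: contraNneq ntV => /esym cF.
  have FT : F = setT.
    by apply/eqP; rewrite eqEcard subsetT cardsT cF leqnn.
  apply/eqP/trivgP/subsetP=> v Vv; rewrite inE; apply/eqP/permP=> x; rewrite perm1.
  by have : x \in F; [rewrite FT inE | move/afixP/(_ v Vv)].
have two c1 c2 (A : {set T}) : c1 != c2 -> c1 \in A -> c2 \in A -> 1 < #|A|.
  by move=> *; apply/card_gt1P; exists c1, c2.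
have mod1 A : [acts P, on A | 'P] -> a \in A -> 1 < #|A| -> #|A| < #|T| -> #|A| = p.+1.
  move=> actA aA A1 AT; have := acts_card_mod oP fixP actA; rewrite aA.
  by apply: mod1_below; rewrite -?cardT.
have cF : #|F| = p.+1 by apply: mod1; rewrite ?(two a b).
(* The orbit of [a] is not a singleton because [Q] moves [a], so the same congruence gives it p + 1
   points. *)
have orbF : orbit 'P H a = F.
  have sOF : orbit 'P H a \subset F by rewrite acts_sub_orbit.
  apply/eqP; rewrite eqEcard sOF cF -(mod1 (orbit 'P H a)) ?orbit_refl //.
  - by rewrite leqnn.
  - exact: subset_trans sPH (acts_orbit 'P a (subsetT _)).
  - rewrite ltnNge; apply/negP=> le1.
    have /card_orbit1/orbit1P/(subsetP (afixS 'P sQH)) : #|orbit 'P H a| = 1%N.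
      apply/eqP; rewrite eqn_leq le1 card_gt0; apply/set0Pn; exists a.
      exact: orbit_refl.
    by rewrite fixQ inE (negPf neq_ab).
  exact: leq_ltn_trans (subset_leq_card sOF) F_lt.
have trH : [transitive H, on F | 'P] by rewrite -orbF; apply: atrans_orbit.
set K := 'C_H(F | 'P)%G.
have nKH : K <| H.
  by rewrite /normal subsetIl normsI ?normG // (subset_trans actH) ?astab_norm.
have nsHK : ~~ (H \subset K).
  rewrite subsetI subxx /= astabC; apply: contraNN neq_ab => sFH.
  by have := subsetP sFH _ Va; move/(subsetP (afixS 'P sQH)); rewrite fixQ inE.
have [V1 [nV1H sKV1 nsV1K _ [r1 pr_r1 r1V1]]] := solvable_chief_over solH nKH nsHK.
have [sV1H nV1H'] := andP nV1H.
exfalso; have [| |] := card_orbit_fix oP fixP (subset_trans sPH nV1H').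
- move/orbit1P=> V1a; case/negP: nsV1K; rewrite subsetI sV1H astabC -orbF.
  by rewrite acts_sub_orbit // acts_fix_norm.
- move=> oV1; have [|m em] := @p_natP r1 #|orbit 'P V1 a|.
    apply: pnat_dvd r1V1; rewrite card_orbit card_quotient.
      by apply: indexgS; rewrite subsetI sKV1 (subset_trans (subsetIr H _)) ?astabS ?sub1set.
    exact: subset_trans sV1H (normal_norm nKH).
  move: oV1; rewrite em; apply: succ_sophie_germain_not_prime_power => //.
  by rewrite -cardT.
move=> oV1; have : #|T| <= #|F|; last by rewrite leqNgt F_lt.
by rewrite -oV1 -orbF subset_leq_card // imsetS.
Qed.

(** This serves case (B): the pair of [c] and [d] is one block, and its translates by [P] are all
    the blocks. *)
Definition block_perms P a c d : {set {perm T}} :=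
  [set k : {perm T} | (k a == a) && [forall h in P,
     (k (h c) \in [set h c; h d]) && (k (h d) \in [set h c; h d])]].

(** [solvable_trans_prime] puts both groups into one [V] that is abelian modulo the kernel on
    [B]. *)
Lemma commute_on_orbit P Q (B : {set T}) : #|P| = p -> #|Q| = p ->
    solvable (P <*> Q) -> [acts P, on B | 'P] -> [acts Q, on B | 'P] ->
    [transitive P, on B | 'P] -> #|B| = p ->
  [~: P, Q] \subset 'C(B | 'P).
Proof.
move=> oP oQ solH actP actQ trP cB.
have trH : [transitive P <*> Q, on B | 'P].
  by rewrite (atrans_supgroup (joing_subl P Q) trP) join_subG actP.
have [|V [_ _ dV _ inV]] := solvable_trans_prime solH trH; first by rewrite cB.
apply: subset_trans (subset_trans dV (subsetIr _ _)); apply: commgSS.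
  by apply/subsetP=> y Py; rewrite inV ?(subsetP (joing_subl P Q)) // cB -oP expg_cardG.
by apply/subsetP=> y Qy; rewrite inV ?(subsetP (joing_subr P Q)) // cB -oQ expg_cardG.
Qed.

(** Unless the elementary abelian normal subgroup [V] has order q, it fixes [a]; take a nontrivial
    orbit [B] of it. If [P] preserves [B], the points other than [a] split into two sets of size p,
    on each of which [P] and [Q] commute. Otherwise the translates of [B] are p blocks of size 2. *)
Lemma solvable_pair_fix_eq P Q a :
    #|P| = p -> 'Fix_('P)(P) = [set a] -> #|Q| = p -> 'Fix_('P)(Q) = [set a] ->
    solvable (P <*> Q) ->
  [\/ Q \subset 'C(P),
      exists U : {group {perm T}}, [/\ #|U| = #|T|, P \subset 'N(U) & Q \subset 'N(U)]
    | forall c, c != a -> exists d,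
        (forall y, y != a -> exists2 h, h \in P & y \in [set h c; h d]) /\
        (exists2 k, k \in block_perms P a c d & Q :=: P :^ k)].
Proof.
move=> oP fixP oQ fixQ solH; set H := (P <*> Q)%G.
have sPH : P \subset H := joing_subl P Q.
have sQH : Q \subset H := joing_subr P Q.
have ntH : H :!=: 1.
  apply: contraTneq pr_p => H1; rewrite -oP.
  by move: sPH; rewrite H1 => /trivgP ->; rewrite cards1.
have [V [_ nVH ntV /is_abelemP[r pr_r /abelem_pgroup rV]]] :=
  solvable_norm_abelem solH (normal_refl H) ntH.
have [sVH nVH'] := andP nVH.
have nVP := subset_trans sPH nVH'; have nVQ := subset_trans sQH nVH'.
have Va : orbit 'P V a = [set a] \/ #|V| = #|T|.
  case: (card_orbit_fix oP fixP nVP); first by left.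
    by move/(no_succ_orbit pr_r rV).
  by move/(pgroup_norm_prime_degree pr_r rV); right.
case: Va => [Va | oV]; last by constructor 2; exists V.
have Ha h : h \in H -> h a = a.
  have : H \subset 'C[a | 'P].
    by rewrite join_subG !sub_astab1 fixP fixQ set11.
  by move/subsetP/[apply]/astab1P.
have [x /eqP Bx] : exists x, orbit 'P V x != [set x].
  apply/existsP; apply: contraNT ntV => /existsPn Vfix.
  apply/eqP/trivgP/subsetP=> v Vv; rewrite inE; apply/eqP/permP=> x; rewrite perm1.
  by have := Vfix x; rewrite negbK => /eqP/orbit1P/afixP/(_ v Vv).
have xa : x != a by apply: contra_not_neq Bx => ->.
set B := orbit 'P V x in Bx.
have aB : a \notin B by rewrite orbit_sym Va inE.
have [m cB] := prime_power_orbit x pr_r rV; rewrite -/B in cB.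
have B_gt1 : 1 < #|B|.
  have := orbit_refl 'P V x; rewrite ltnNge -/B => xB.
  apply/negP=> le1; apply: Bx; apply/card_orbit1/eqP; rewrite eqn_leq le1.
  by rewrite card_gt0; apply/set0Pn; exists x.
have [actP | [cO cC]] := norm_blocks x (etrans (congr1 prime oP) pr_p : prime #|P|) nVP.
  constructor 1.
  have := acts_card_mod oP fixP actP; rewrite -/B (negPf aB) mod0n => /eqP pB.
  have r_p : r = p.
    by move: pB; rewrite -/(dvdn p _) cB Euclid_dvdX // dvdn_prime2 // => /andP[/eqP].
  have B_le : #|B| <= 2 * p + 1 by rewrite -cardT max_card.
  have cBp : #|B| = p.
    by move: B_gt1 B_le; rewrite cB r_p; apply: expn_below.
  (* If [Q] moved [B], its p disjoint translates would need p^2 points, more than 2p + 1. *)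
  have actQ : [acts Q, on B | 'P].
    have [//|[_ cC]] := norm_blocks x (etrans (congr1 prime oQ) pr_p : prime #|Q|) nVQ.
    have := max_card (mem (cover (orbit ('P^*)%act Q B))).
    rewrite cC cardT oQ -/B cBp => le_pp.
    have := leq_trans (leq_mul p_ge5 (leqnn p)) le_pp; rewrite leqNgt; case/negP.
    by clear -p_ge5; lia.
  have trP (A : {set T}) y : [acts P, on A | 'P] -> #|A| = p -> y \in A -> y != a ->
      [transitive P, on A | 'P].
    move=> actA cA Ay ya; suff <- : orbit 'P P y = A by apply: atrans_orbit.
    by apply/eqP; rewrite eqEcard acts_sub_orbit // Ay cA (card_orbit_nfix oP fixP ya) leqnn.
  set B' := ~: (a |: B).
  have cB' : #|B'| = p.
    by rewrite cardsCs setCK cardsU1 aB cBp cardT add1n addn1 subSS mul2n -addnn addnK.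
  have acts' R : R \subset H -> [acts R, on B | 'P] -> [acts R, on B' | 'P].
    move=> sRH actR; rewrite /acts_on astabsC; apply: subset_trans (astabsU _ _ _).
    rewrite subsetI actR andbT astabs_set1 sub_astab1.
    by apply/afixP=> h Rh; apply: Ha; rewrite (subsetP sRH).
  have [y B'y] : exists y, y \in B' by apply/card_gt0P; rewrite cB' prime_gt0.
  have ya : y != a by move: B'y; rewrite !inE negb_or => /andP[].
  have c1 := commute_on_orbit oP oQ solH actP actQ (trP _ _ actP cBp (orbit_refl _ _ _) xa) cBp.
  have actP' := acts' P sPH actP; have actQ' := acts' Q sQH actQ.
  have c2 := commute_on_orbit oP oQ solH actP' actQ' (trP _ _ actP' cB' B'y ya) cB'.
  rewrite centsC; apply/commG1P/trivgP/subsetP=> g PQg.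
  rewrite inE; apply/eqP/permP=> z; rewrite perm1.
  have [-> | za] := eqVneq z a.
    by apply: Ha; apply: (subsetP _ _ PQg); rewrite comm_subG.
  have [Bz | nBz] := boolP (z \in B); first exact: (astab_act (subsetP c1 g PQg) Bz).
  by apply: (astab_act (subsetP c2 g PQg)); rewrite !inE negb_or za.
constructor 3; rewrite -/B in cO cC.
set Om := orbit ('P^*)%act P B in cO cC.
have cB2 : #|B| = 2.
  have := max_card (mem (cover Om)); rewrite cC cardT oP.
  move=> le_pB; apply/eqP; rewrite eqn_leq B_gt1 andbT leqNgt; apply/negP=> B3.
  have := leq_trans (leq_mul (leqnn p) B3) le_pB; rewrite leqNgt; case/negP.
  by clear -p_ge5; lia.
have OmP A : A \in Om -> exists2 y, A = orbit 'P V y & y != a.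
  case/orbitP=> h Ph <-; exists (h x); first by rewrite orbit_norm ?(subsetP nVP).
  by rewrite -[X in _ != X](Ha h) ?(subsetP sPH) // (inj_eq (@perm_inj _ h)).
have OmA A : A \in Om -> #|A| = 2 by case/orbitP=> h Ph <-; rewrite card_setact.
have covOm : cover Om = ~: [set a].
  apply/eqP; rewrite eqEcard cC oP cB2 cardsC1 cardT addn1 /= mulnC leqnn andbT.
  apply/bigcupsP=> A /OmP[y -> ya]; rewrite subsetC sub1set inE.
  by rewrite orbit_sym Va inE.
have OmV y : y != a -> orbit 'P V y \in Om.
  move=> ya; have : y \in cover Om by rewrite covOm !inE.
  case/bigcupP=> A OmA' Ay; have [u defA _] := OmP A OmA'.
  by move: Ay OmA'; rewrite defA => /orbit_eqP ->.
have trP : [transitive P, on Om | 'P^*] by apply: atrans_orbit.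
have trH : [transitive H, on Om | 'P^*].
  rewrite (atrans_supgroup sPH trP); apply/subsetP=> h Hh.
  apply/astabsP=> A; have inOm g A' : g \in H -> A' \in Om -> ('P^*)%act A' g \in Om.
    move=> Hg /OmP[y -> ya]; rewrite orbit_norm ?(subsetP nVH') // OmV //.
    by rewrite -[X in _ != X](Ha g) // (inj_eq (@perm_inj _ g)).
  apply/idP/idP; last exact: inOm.
  by move/(inOm h^-1); rewrite groupV -actM mulgV act1; apply.
have cOm : #|Om| = p by rewrite cO.
(* Galois's theorem is applied to the action on the p blocks. *)
have [|W [nWH sKW _ cW inW]] := solvable_trans_prime solH trH; first by rewrite cOm.
set K := ('C_H(Om | 'P^*))%G in sKW cW.
have sPW : P \subset W.
  by apply/subsetP=> y Py; rewrite inW ?(subsetP sPH) // cOm -oP expg_cardG.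
have sQW : Q \subset W.
  by apply/subsetP=> y Qy; rewrite inW ?(subsetP sQH) // cOm -oQ expg_cardG.
have Kblock k A y : k \in K -> A \in Om -> y \in A -> k y \in A.
  case/setIP=> _ /astab_act kA /kA eA yA.
  suff : k y \in ('P^*)%act A k by rewrite eA.
  by apply/imsetP; exists y.
have K2 k : k \in K -> k ^+ 2 = 1.
  move=> Kk; apply/permP=> y; rewrite perm1 expgS expg1 permM.
  have [->|ya] := eqVneq y a.
    by rewrite !Ha // (subsetP (subsetIl H _) _ Kk).
  have OmY := OmV y ya; have Ay := orbit_refl 'P V y.
  have Aky := Kblock _ _ _ Kk OmY Ay; have Akky := Kblock _ _ _ Kk OmY Aky.
  have [kyy|kyy] := eqVneq (k y) y; first by rewrite !kyy.
  have kky : k (k y) != k y by rewrite (inj_eq (@perm_inj _ k)).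
  apply/eqP; apply: contraTT isT => kkyy.
  have : #|[set y; k y; k (k y)]| <= 2.
    rewrite -(OmA _ OmY) subset_leq_card //; apply/subsetP=> z; rewrite !inE.
    by case/orP=> [/orP[]|] /eqP->.
  by rewrite setUC cardsU1 cards2 !inE negb_or kkyy kky eq_sym kyy.
(* Elements of [K] square to 1, so [P] and [Q] are Sylow in [W], and [W] is [P * K]: the conjugating
   element can be taken in [K]. *)
have p_K : ~~ (p %| #|K|).
  apply/negP=> /(Cauchy pr_p) [z Kz oz].
  have : #[z] %| 2 by rewrite order_dvdn K2.
  by rewrite oz => /dvdn_leq - /(_ isT); rewrite leqNgt (leq_trans _ p_ge5).
have sylp R : R \subset W -> #|R| = p -> p.-Sylow(W) R.
  move=> sRW oR; rewrite pHallE sRW oR cW cOm p_part lognM ?cardG_gt0 ?prime_gt0 //.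
  by rewrite logn_prime // eqxx lognE (negPf p_K) !andbF addn0 expn1 eqxx.
have [w Ww defQ] := Sylow_trans (sylp P sPW oP) (sylp Q sQW oQ).
have defW : P * K = W.
  apply/eqP; rewrite eqEcard mul_subG //= cW cOm TI_cardMg ?oP //.
  by apply: coprime_TIg; rewrite oP prime_coprime.
have := Ww; rewrite -defW => /mulsgP[u k Pu Kk defw].
move=> c ca; have OmC := OmV c ca.
have := OmA _ OmC; set C := orbit 'P V c => cC2.
have [d defC] : exists d, C = [set c; d].
  have : #|C :\ c| = 1%N by have := cardsD1 c C; rewrite orbit_refl cC2 => -[].
  by case/eqP/cards1P=> d Cd; exists d; rewrite -Cd setD1K ?orbit_refl.
have imC h : ('P^*)%act C h = [set h c; h d].
  by rewrite defC /= /setact imsetU1 imset_set1.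
exists d; split=> [y ya|].
  have OmY := OmV y ya; have [h Ph eY] := atransP2 trP OmC OmY.
  by exists h; rewrite // -imC -eY orbit_refl.
exists k; last by rewrite defQ defw conjsgM (conjGid Pu).
rewrite inE Ha ?(subsetP (subsetIl H _) _ Kk) // eqxx /=.
apply/forall_inP=> h Ph; have OmCh : [set h c; h d] \in Om.
  by rewrite -imC; rewrite (acts_act (atrans_acts trP) Ph).
by rewrite !(Kblock k) ?set21 ?set22.
Qed.

End PrimeOneFixedPoint.

(** * Counting *)

Lemma leq_card_bigcup (I J : finType) (A : {pred I}) (F : I -> {set J}) n :
  (forall i, i \in A -> #|F i| <= n) -> #|\bigcup_(i in A) F i| <= #|A| * n.
Proof.
move=> leF; rewrite -sum_nat_const.
elim/big_rec2: _ => [|i B m Ai le_m]; first by rewrite cards0.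
by rewrite (leq_trans (leq_card_setU _ _)) // leq_add ?leF.
Qed.

(* The left-hand side is the product of the bounds on the number of P, of Q and
   of Y in the count of exists_insoluble_prime_degree. *)
Lemma bad_count_lt_fact p : 5 <= p ->
  (2 * p + 1) * (2 * p ^ 2 + (2 * p + 1) * 2 ^ p + p * p.-1 * (2 * p + 1)) * (p * p.-1)
    < (2 * p - 1)`!.
Proof.
elim: p => // p IHp; rewrite leq_eqVlt => /predU1P[<-|p5].
  by rewrite (_ : (2 * 5 - 1)`! = 9`!)%N // !factS fact0; lia.
have {IHp} := IHp p5; have -> : (2 * p.+1 - 1 = (2 * p - 1).+2)%N by lia.
rewrite !factS (expnS 2); move: (2 ^ p)%N (_`!)%N => P F.
(* From p to p + 1 the left-hand side grows by a factor of at most 2 * 8 * 2 = 32, the factorial by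
   2p(2p + 1), which exceeds 32. *)
have le1 : 2 * p.+1 + 1 <= 2 * (2 * p + 1) by lia.
have le2 : p.+1 * p.+1.-1 <= 2 * (p * p.-1).
  by rewrite mulnC mulnCA leq_mul2l; apply/orP; right; lia.
have le3 : 2 * p.+1 ^ 2 <= 8 * (2 * p ^ 2).
  have : p.+1 ^ 2 <= (2 * p) ^ 2 by rewrite leq_exp2r; lia.
  by rewrite expnMn; lia.
have le4 : (2 * p.+1 + 1) * (2 * P) <= 8 * ((2 * p + 1) * P).
  by have := leq_mul le1 (leqnn (2 * P)); lia.
have le5 : p.+1 * p.+1.-1 * (2 * p.+1 + 1) <= 8 * (p * p.-1 * (2 * p + 1)).
  by have := leq_mul le2 le1; lia.
set A := (2 * p + 1)%N in le1 le4 le5 *; set B := (p * p.-1)%N in le2 le5 *.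
set A' := (2 * p.+1 + 1)%N in le1 le4 le5 *.
set B' := (p.+1 * p.+1.-1)%N in le2 le5 *.
move=> ltF; have := leq_mul (leq_mul le1 (leq_add (leq_add le3 le4) le5)) le2.
move/leq_ltn_trans; apply; rewrite -!mulnDr.
set C := (_ + _ + _)%N in ltF *.
have -> : (2 * A * (8 * C) * (2 * B) = 32 * (A * C * B))%N by lia.
apply: (@leq_ltn_trans (32 * F)%N).
  by rewrite leq_mul2l ltnW.
rewrite mulnA ltn_mul2r (leq_ltn_trans _ ltF) //=.
have := @leq_mul 5 5 (2 * p - 1).+2 (2 * p - 1).+1 ltac:(lia) ltac:(lia).
have := @leq_mul 9 9 (2 * p - 1).+2 (2 * p - 1).+1 ltac:(lia) ltac:(lia).
lia.
Qed.

Section Counting.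

Variables (T : finType) (p : nat).
Hypotheses (pr_p : prime p) (p_ge5 : 5 <= p).
Hypotheses (cardT : #|T| = (2 * p + 1)%N) (pr_T : prime #|T|).
Implicit Types (U X Y P Q : {group {perm T}}) (a b c d : T).

Local Notation q := #|T|.

Let p_gt0 : 0 < p := prime_gt0 pr_p.
Let q_gt0 : 0 < q := prime_gt0 pr_T.
Let predqE : q.-1 = (2 * p)%N. Proof. by rewrite cardT addn1. Qed.

Let q_mod : q = 1 %[mod p].
Proof. by rewrite cardT -modnDml modnMl. Qed.

(** The degree is 1 modulo p, so [P] fixes a point; a second one would make [P] trivial by
    [norm_prime_degree_fix2]. *)
Lemma fix_in_norm P X : #|X| = q -> #|P| = p -> P \subset 'N(X) ->
  exists a, 'Fix_('P)(P) = [set a].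
Proof.
move=> oX oP nXP; have pP : p.-group P by rewrite /pgroup oP pnat_id.
have : #|'Fix_('P)(P)| != 0%N.
  have : [acts P, on [set: T] | 'P] by apply/actsP=> h _ x; rewrite !inE.
  move/(pgroup_fix_mod pP); rewrite setTI cardsT q_mod => e.
  by apply: contra_eq_neq e => ->; rewrite mod0n modn_small ?prime_gt1.
rewrite cards_eq0 => /set0Pn[a Fa]; exists a; apply/eqP.
rewrite eqEsubset sub1set Fa andbT; apply/subsetP=> b Fb; rewrite inE.
apply/negPn/negP=> ba.
suff P1 : P :=: 1 by move: pr_p; rewrite -oP P1 cards1.
apply/trivgP/subsetP=> h Ph; rewrite inE; apply/eqP.
apply: (norm_prime_degree_fix2 pr_T oX (subsetP nXP h Ph) ba).
  by move/afixP: Fb => /(_ h Ph).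
by move/afixP: Fa => /(_ h Ph).
Qed.

(** The centraliser fixes [a] and sends [c] to at most 2p points. Once it fixes [c], it fixes the
    [P]-orbit of [c] pointwise, which leaves p images for [d] in the other orbit; fixing [d] too
    forces the identity. *)
Lemma card_cent_leq P a : #|P| = p -> 'Fix_('P)(P) = [set a] -> #|'C(P)| <= 2 * p ^ 2.
Proof.
move=> oP fixP.
have Ca h : h \in 'C(P) -> h a = a.
  have : [acts 'C(P), on 'Fix_('P)(P) | 'P].
    by apply: acts_fix_norm; apply: cent_sub.
  by move/actsP=> actC Ch; have := actC h Ch a; rewrite fixP !inE eqxx => /eqP.
have cardC1 (x : T) : #|~: [set x]| = (2 * p)%N by rewrite cardsC1 predqE.
have [c ca] : exists c, c != a.
  have /card_gt0P[c] : 0 < #|~: [set a]| by rewrite cardC1 muln_gt0.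
  by rewrite !inE; exists c.
have cO := card_orbit_nfix pr_p oP fixP ca; set O := orbit 'P P c in cO.
have aO : a \notin O.
  rewrite orbit_sym; have /orbit1P -> : a \in 'Fix_('P)(P) by rewrite fixP set11.
  by rewrite inE.
have cA' : #|~: (a |: O)| = p.
  by rewrite cardsCs setCK cardsU1 aO cO cardT add1n addn1 subSS mul2n -addnn addnK.
have [d dA] : exists d, d \in ~: (a |: O) by apply/card_gt0P; rewrite cA'.
set C1 := 'C_('C(P))[c | 'P]%G; set C2 := 'C_C1[d | 'P]%G.
have C1fix h x : h \in C1 -> x \in a |: O -> h x = x.
  case/setIP=> Ch /astab1P hc /setU1P[->|]; first exact: Ca.
  case/orbitP=> g Pg <-; rewrite /= /aperm -permM -(centP Ch g Pg) permM.
  by congr (g _); apply: hc.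
have C2_1 : #|C2| = 1%N.
  apply/eqP; rewrite -trivg_card1; apply/eqP/trivgP/subsetP=> h.
  case/setIP=> C1h /astab1P hd; rewrite inE; apply/eqP/permP=> x; rewrite perm1.
  have [|nx] := boolP (x \in a |: O); first exact: C1fix.
  have Ch : h \in 'C(P) by have [] := setIP C1h.
  have da : d != a by move: dA; rewrite !inE negb_or => /andP[].
  have sO : orbit 'P P d = ~: (a |: O).
    apply/eqP; rewrite eqEcard cA' (card_orbit_nfix pr_p oP fixP da) leqnn andbT.
    apply/subsetP=> y dy; rewrite inE; apply: contraL dA => yA; rewrite inE negbK.
    case/setU1P: yA dy => [->|yO].
      rewrite orbit_sym; have /orbit1P -> : a \in 'Fix_('P)(P) by rewrite fixP set11.
      by rewrite inE => /eqP->; rewrite setU11.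
    by rewrite orbit_sym => dy; rewrite inE (orbit_trans dy yO) orbT.
  have : x \in orbit 'P P d by rewrite sO inE.
  case/orbitP=> g Pg <-; rewrite /= /aperm -permM -(centP Ch g Pg) permM.
  by congr (g _); apply: hd.
have e1 := card_orbit_stab 'P 'C(P) c; have e2 := card_orbit_stab 'P C1 d.
have le1 : #|orbit 'P 'C(P) c| <= 2 * p.
  rewrite -(cardC1 a) subset_leq_card //; apply/subsetP=> y /orbitP[h Ch <-].
  by rewrite !inE -[X in _ != X](Ca h Ch) (inj_eq (@perm_inj _ h)).
have le2 : #|orbit 'P C1 d| <= p.
  rewrite -[X in _ <= X]cA' subset_leq_card //; apply/subsetP=> y /orbitP[h C1h <-].
  rewrite inE; apply: contraL dA => hdA; rewrite inE negbK.
  by have /(@perm_inj _ h) <- := C1fix _ _ C1h hdA.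
have {}e1 : (#|orbit 'P 'C(P) c| * #|C1| = #|'C(P)|)%N := e1.
have {}e2 : (#|orbit 'P C1 d| * #|C2| = #|C1|)%N := e2.
rewrite -e1 -e2 C2_1 muln1.
by rewrite expnS expn1 mulnA leq_mul.
Qed.

Lemma card_norm_leq P a : #|P| = p -> 'Fix_('P)(P) = [set a] ->
  #|'N(P)| <= 2 * p ^ 2 * p.-1.
Proof.
move=> oP fixP; have := @dvdn_card_norm_cyclic _ [group of [set: {perm T}]] P.
rewrite prime_cyclic ?oP // !setTI totient_prime // => /(_ isT) /dvdn_leq le.
apply: leq_trans (le _) _.
  by rewrite muln_gt0 cardG_gt0 -subn1 subn_gt0 prime_gt1.
by rewrite leq_mul2r (card_cent_leq oP fixP) orbT.
Qed.

Lemma norm_der1_sub X : #|X| = q -> 'N(X)^`(1) \subset X.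
Proof.
move=> oX; suff : 'N(X)^`(1) \subset 'C(X) by rewrite cent_prime_degree.
rewrite -ker_conj_aut ker_trivg_morphim der_sub morphim_der //.
suff /derG1P -> : abelian (conj_aut X @* 'N(X)) by exact: subxx.
apply: abelianS (Aut_conj_aut _ _) (Aut_cyclic_abelian _).
by rewrite prime_cyclic ?oX.
Qed.

Lemma Sylow_norm_prime_degree P X : #|X| = q -> #|P| = p -> P \subset 'N(X) ->
  p.-Sylow('N(X)) P.
Proof.
move=> oX oP nXP; rewrite pHallE nXP oP card_norm_prime_degree // predqE.
have nq : ~~ (p %| q) by rewrite /dvdn q_mod modn_small ?prime_gt1.
have n2 : ~~ (p %| 2) by apply/negP=> /dvdn_leq - /(_ isT); rewrite leqNgt (leq_trans _ p_ge5).
have lq : logn p q = 0%N by rewrite lognE (negPf nq) !andbF.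
have l2 : logn p 2 = 0%N by rewrite lognE (negPf n2) !andbF.
by rewrite p_part !lognM ?muln_gt0 ?q_gt0 ?p_gt0 // lq l2 logn_prime // eqxx expn1 /=.
Qed.

(** By the Frattini argument [X] times this normaliser is ['N(X)], of order 2pq. It applies because
    [X <*> P] contains the derived subgroup and so is normal. *)
Lemma card_normI_geq P X : #|X| = q -> #|P| = p -> P \subset 'N(X) ->
  2 * p <= #|'N_('N(X))(P)|.
Proof.
move=> oX oP nXP.
have nXPN : X <*> P <| 'N(X).
  apply: sub_der1_normal; first exact: subset_trans (norm_der1_sub oX) (joing_subl _ _).
  by rewrite join_subG normG.
have sylP : p.-Sylow(X <*> P) P.
  by apply: pHall_subl (joing_subr _ _) (normal_sub nXPN) (Sylow_norm_prime_degree oX oP nXP).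
have := Frattini_arg nXPN sylP; rewrite /= norm_joinEr // -mulgA mulSGid; last first.
  by rewrite subsetI nXP normG.
move/(congr1 (fun A : {set _} => #|A|)); rewrite card_norm_prime_degree // predqE => e.
by rewrite -(leq_pmul2l q_gt0) -e -oX mul_cardG leq_pmulr ?cardG_gt0.
Qed.

Definition normalized_by P := [set Y : {group {perm T}} | (#|Y| == q) && (P \subset 'N(Y))].
Definition normalizing Y := [set P : {group {perm T}} | (#|P| == p) && (P \subset 'N(Y))].

(** By Sylow's theorem in ['N(X)], all these groups are conjugate under ['N(P)], of order at most
    2p^2(p - 1), where the stabiliser of [X] has order at least 2p. *)
Lemma card_normalized_by P : #|P| = p -> #|normalized_by P| <= p * p.-1.
Proof.
move=> oP; have [->|[X]] := set_0Vmem (normalized_by P); first by rewrite cards0.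
rewrite inE => /andP[/eqP oX nXP]; have [a fixP] := fix_in_norm oX oP nXP.
have sO : normalized_by P \subset orbit 'JG 'N(P) X.
  apply/subsetP=> Y; rewrite inE => /andP[/eqP oY nYP].
  have [g defY] := prime_degree_conj pr_T oX oY.
  have nXPg : P :^ g^-1 \subset 'N(X) by rewrite -(conjsgK g X) -defY normJ conjSg.
  have [n Nn defPg] := Sylow_trans (Sylow_norm_prime_degree oX (etrans (cardJg P g^-1) oP) nXPg)
     (Sylow_norm_prime_degree oX oP nXP).
  apply/orbitP; exists (n^-1 * g); last first.
    apply/group_inj; rewrite /= defY conjsgM; congr (_ :^ g).
    by apply/normP; rewrite groupV.
  have e : P :^ n^-1 = P :^ g^-1 by rewrite {1}defPg conjsgK.
  by apply/normP; rewrite conjsgM e conjsgKV.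
apply: leq_trans (subset_leq_card sO) _.
have := card_orbit_stab 'JG 'N(P) X; rewrite astab1JG setIC => e.
have := card_normI_geq oX oP nXP => le1.
have := card_norm_leq oP fixP; rewrite -e => le2.
have := leq_trans (leq_mul (leqnn #|orbit 'JG 'N(P) X|) le1) le2.
rewrite (_ : 2 * p ^ 2 * p.-1 = p * p.-1 * (2 * p))%N ?leq_pmul2r ?muln_gt0 //.
by rewrite expnS expn1 mulnC mulnA mulnCA [in RHS]mulnAC mulnC; lia.
Qed.

Lemma card_normalizing X : #|X| = q -> #|normalizing X| <= q.
Proof.
move=> oX; have [->|[P]] := set_0Vmem (normalizing X); first by rewrite cards0.
rewrite inE => /andP[/eqP oP nXP].
have sS : normalizing X \subset 'Syl_p('N(X)).
  apply/subsetP=> Q; rewrite !inE => /andP[/eqP oQ nXQ].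
  exact: Sylow_norm_prime_degree.
apply: leq_trans (subset_leq_card sS) _.
rewrite (card_Syl (Sylow_norm_prime_degree oX oP nXP)).
have := Lagrange (subsetIl 'N(X) 'N(P)); rewrite card_norm_prime_degree // predqE => e.
have := leq_mul (card_normI_geq oX oP nXP) (leqnn #|'N(X) : 'N_('N(X))(P)|).
by rewrite e mulnC leq_pmul2r ?muln_gt0.
Qed.

Lemma card_prime_degree_groups : #|[set Y : {group {perm T}} | #|Y| == q]| = (q - 2)`!.
Proof.
have [X [_ oX]] : exists X : {group {perm T}}, X \subset [set: {perm T}] /\ #|X| = q.
  have [X sylX] := Sylow_exists q [group of [set: {perm T}]].
  exists X; split; rewrite ?subsetT // (card_Hall sylX) card_setTperm //.
  exact: part_fact_prime_degree.
have -> : [set Y : {group {perm T}} | #|Y| == q] = 'Syl_q([set: {perm T}]).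
  apply/setP=> Y; rewrite !inE; apply/eqP/idP=> [|sylY]; first exact: Sylow_prime_degree.
  by rewrite (card_Hall sylY) card_setTperm // part_fact_prime_degree.
rewrite (card_Syl (Sylow_prime_degree pr_T oX)) setTI.
have := Lagrange (subsetT 'N(X)); rewrite card_setTperm // card_norm_prime_degree //.
rewrite fact_prime_degree // -mulnA => /eqP; rewrite eqn_pmul2l // => /eqP.
have -> : q.-1 = (q - 2).+1 by have := prime_gt1 pr_T; lia.
by rewrite factS => /eqP; rewrite eqn_pmul2l // => /eqP.
Qed.

Lemma perm_pair (k : {perm T}) u v : k u \in [set u; v] -> k v \in [set u; v] ->
  if k u == u then k v = v else k u = v /\ k v = u.
Proof.
rewrite !inE; have ik := @perm_inj _ k; case: eqVneq => [ku _|ku /=].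
  by case/orP=> /eqP kv //; rewrite kv; apply: ik; rewrite kv ku.
move/eqP=> kuv /orP[] /eqP kv //; case/eqP: ku.
by rewrite kuv; apply: ik; rewrite kuv kv.
Qed.

(** Such a [k] is the identity or the swap on each pair, so it is determined by the set of [h] in
    [P] for which it fixes [h c]. *)
Lemma card_block_perms P a c d :
    (forall y, y != a -> exists2 h : {perm T}, h \in P & y \in [set h c; h d]) ->
  #|block_perms P a c d| <= 2 ^ #|P|.
Proof.
move=> cov; rewrite -card_powerset.
pose f (k : {perm T}) := [set h in P | k (h c) == h c].
have injf : {in block_perms P a c d &, injective f}.
  move=> k k'; rewrite inE => /andP[/eqP ka /forall_inP kB].
  rewrite inE => /andP[/eqP k'a /forall_inP k'B] eqf.
  apply/permP=> y; have [->|ya] := eqVneq y a; first by rewrite ka.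
  have [h Ph] := cov y ya.
  have /andP[k1 k2] := kB h Ph; have /andP[k3 k4] := k'B h Ph.
  have : (h \in f k) = (h \in f k') by rewrite eqf.
  rewrite !inE Ph /=; have := perm_pair k1 k2; have := perm_pair k3 k4.
  case: (k (h c) =P _) => [ku|_]; case: (k' (h c) =P _) => [k'u|_] //.
    by move=> k'v kv _ /orP[] /eqP->; rewrite ?ku ?k'u ?kv ?k'v.
  by move=> [k'u k'v] [ku kv] _ /orP[] /eqP->; rewrite ?ku ?k'u ?kv ?k'v.
rewrite -(card_in_imset injf) subset_leq_card //.
by apply/subsetP=> _ /imsetP[k _ ->]; rewrite inE; apply/subsetP=> h; rewrite inE => /andP[].
Qed.

(** The middle condition keeps the [Q] that can arise from some [Y]; by [fix_in_norm] it gives [Q] a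
    unique fixed point. *)
Definition soluble_partners P := [set Q : {group {perm T}} |
  [&& #|Q| == p, normalized_by Q != set0 & solvable (P <*> Q)]].

Lemma card_soluble_partners P X : #|X| = q -> P \in normalizing X ->
  #|soluble_partners P| <= 2 * p ^ 2 + q * 2 ^ p + p * p.-1 * q.
Proof.
move=> oX; rewrite inE => /andP[/eqP oP nXP]; have [a fixP] := fix_in_norm oX oP nXP.
have [c ca] : exists c, c != a.
  have /card_gt0P[c] : 0 < #|~: [set a]| by rewrite cardsC1 predqE muln_gt0.
  by rewrite !inE; exists c.
(* [A], [B] and [C] collect cases (A), (B) and (C), and [D] holds the possible partners [d] of [c]
   in a block. In case (A), [Q] is cyclic, hence given by one element of the centraliser. *)
pose D := [set d | [forall y, (y != a) ==> [exists h in P, y \in [set h c; h d]]]].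
pose A := [set <[h]>%G | h in 'C(P)].
pose B := \bigcup_(d in D) [set (P :^ k)%G | k in block_perms P a c d].
pose C := \bigcup_(U in normalized_by P) normalizing U.
have cA : #|A| <= 2 * p ^ 2 by apply: leq_trans (leq_imset_card _ _) (card_cent_leq oP fixP).
have cB : #|B| <= q * 2 ^ p.
  apply: leq_trans (leq_mul (max_card (mem D)) (leqnn _)).
  apply: leq_card_bigcup => d; rewrite inE => /forallP cov.
  apply: leq_trans (leq_imset_card _ _) _; rewrite -oP; apply: card_block_perms.
  by move=> y ya; have := cov y; rewrite ya => /exists_inP.
have cC : #|C| <= p * p.-1 * q.
  apply: leq_trans (leq_mul (card_normalized_by oP) (leqnn _)).
  by apply: leq_card_bigcup => U; rewrite inE => /andP[/eqP oU _]; apply: card_normalizing.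
apply: leq_trans (leq_add (leq_add cA cB) cC).
apply: leq_trans (leq_add (leq_card_setU A B) (leqnn _)).
apply: leq_trans (leq_card_setU _ C); apply: subset_leq_card.
apply/subsetP=> Q; rewrite inE => /and3P[/eqP oQ /set0Pn[Y]].
rewrite inE => /andP[/eqP oY nYQ] solPQ; have [b fixQ] := fix_in_norm oY oQ nYQ.
have inC : (exists U : {group {perm T}},
    [/\ #|U| = q, P \subset 'N(U) & Q \subset 'N(U)]) -> Q \in C.
  by case=> U [oU nUP nUQ]; apply/bigcupP; exists U; rewrite inE ?oU ?oQ eqxx.
rewrite !inE; have [eq_ab|neq_ab] := eqVneq a b; last first.
  have := solvable_pair_fix_neq pr_p p_ge5 cardT pr_T oP fixP oQ fixQ neq_ab solPQ.
  by move/inC ->; rewrite orbT.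
rewrite -eq_ab in fixQ.
have [cPQ|/inC->|] := solvable_pair_fix_eq pr_p p_ge5 cardT pr_T oP fixP oQ fixQ solPQ.
- have /cyclicP[h defQ] : cyclic Q by rewrite prime_cyclic ?oQ.
  suff -> : Q \in A by [].
  apply/imsetP; exists h; last exact: group_inj.
  by rewrite (subsetP cPQ) // defQ cycle_id.
- by rewrite orbT.
move=> /(_ c ca) [d [cov [k kB defQ]]]; suff -> : Q \in B by rewrite orbT.
apply/bigcupP; exists d.
  rewrite inE; apply/forallP=> y; apply/implyP=> ya; apply/exists_inP.
  by have [h Ph yh] := cov y ya; exists h.
by apply/imsetP; exists k => //; apply: group_inj.
Qed.

Lemma exists_insoluble_prime_degree X : #|X| = q ->
  exists2 Y : {group {perm T}}, #|Y| = q &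
    forall P Q, P \in normalizing X -> Q \in normalizing Y -> ~~ solvable (P <*> Q).
Proof.
move=> oX.
(* The three successive choices of [P], [Q] and [Y] give the three factors in
   [bad_count_lt_fact]. *)
pose bad := \bigcup_(P in normalizing X) \bigcup_(Q in soluble_partners P) normalized_by Q.
have c_bad : #|bad| < (q - 2)`!.
  have -> : (q - 2 = 2 * p - 1)%N by rewrite cardT addn1 subnS subSS subn1 subn0.
  have := bad_count_lt_fact p_ge5; rewrite -cardT; apply: leq_ltn_trans.
  rewrite -mulnA; apply: leq_trans (leq_mul (card_normalizing oX) (leqnn _)).
  apply: leq_card_bigcup => P PX.
  apply: leq_trans (leq_mul (card_soluble_partners oX PX) (leqnn _)).
  by apply: leq_card_bigcup => Q; rewrite inE => /and3P[/eqP oQ _ _]; apply: card_normalized_by.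
have [Y] : exists Y, Y \in [set Y : {group {perm T}} | #|Y| == q] :\: bad.
  apply/set0Pn; rewrite setD_eq0; apply/negP=> /subset_leq_card.
  by rewrite card_prime_degree_groups leqNgt c_bad.
rewrite inE => /andP[nbY]; rewrite inE => /eqP oY; exists Y => // P Q PX.
rewrite inE => /andP[/eqP oQ nYQ]; apply: contra nbY => solPQ.
have QY : Y \in normalized_by Q by rewrite inE oY eqxx.
apply/bigcupP; exists P => //; apply/bigcupP; exists Q => //.
by rewrite inE oQ eqxx solPQ andbT; apply/set0Pn; exists Y.
Qed.

End Counting.

(** * Distances in the soluble graph *)

Section Neighbours.

Variables (T : finType) (p : nat).
Hypotheses (pr_p : prime p) (p_ge5 : 5 <= p).
Hypotheses (cardT : #|T| = (2 * p + 1)%N) (pr_T : prime #|T|).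
Implicit Types (X Y P Q : {group {perm T}}) (x y v w : {perm T}).

Local Notation q := #|T|.

(** The group is transitive with trivial kernel, so the normal subgroup from Galois's theorem has
    order q; it contains [x], hence is [<[x]>]. *)
Lemma solvable_cycle_norm x v : #[x] = q -> solvable <<[set x; v]>> -> v \in 'N(<[x]>).
Proof.
move=> ox sol_xv; pose H := <<[set x; v]>>%G; have solH : solvable H by [].

have Hx : x \in H by rewrite mem_gen ?set21.
have Hv : v \in H by rewrite mem_gen ?set22.
have sxH : <[x]> \subset H by rewrite cycle_subG.
have trH : [transitive H, on [set: T] | 'P].
  rewrite (atrans_supgroup sxH (perm_prime_atrans pr_T ox)).
  by apply/actsP=> h _ a; rewrite !inE.
have [|V [nVH _ _ cV inV]] := solvable_trans_prime solH trH; first by rewrite cardsT.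
have K1 : 'C_H([set: T] | 'P) = 1.
  apply/trivgP/subsetP=> h /setIP[_ /astabP hT]; rewrite inE; apply/eqP/permP=> a.
  by rewrite perm1; apply: hT; rewrite inE.
have defV : <[x]> = V.
  apply/eqP; rewrite eqEcard cycle_subG cV K1 cards1 muln1 cardsT -orderE ox leqnn andbT.
  by apply: inV; rewrite // cardsT -ox expg_order.
by rewrite defV (subsetP (normal_norm nVH)).
Qed.

(** If p does not divide [#[v]], then [#[v]] divides 2q, and v^q is trivial or an involution with at
    most one fixed point. The latter would be a product of p transpositions, which is odd; so [v]
    has order q. *)
Lemma norm_Alt_cases X v : #|X| = q -> v \in 'N(X) -> v \in 'Alt_T -> v != 1 ->
  p %| #[v] \/ X :=: <[v]>.
Proof.
move=> oX nXv Av v1; have [|p_v] := boolP (p %| #[v]); [by left | right].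
have p_odd := odd_prime_geq5 p_ge5 pr_p.
have vq1 : v ^+ q = 1.
  set w := v ^+ q; have nXw : w \in 'N(X) by rewrite groupX.
  have w2 : w * w = 1.
    have : #[v] %| q * 2.
      have := order_dvdG nXv; rewrite card_norm_prime_degree //= cardT addn1 /= mulnA.
      by rewrite Gauss_dvdl // coprime_sym prime_coprime.
    by rewrite order_dvdn expgM => /eqP; rewrite expgS expg1.
  apply: contraTeq (groupX q Av) => w1; rewrite -/w Alt_even negbK.
  have wK : involutive w by move=> a; rewrite -permM w2 perm1.
  rewrite odd_perm_involution //.
  have := cardsC [set a | w a != a]; set M := [set a | _].
  have leF : #|~: M| <= 1.
    rewrite leqNgt; apply: contra w1 => /card_gt1P[a [b [aF bF ab]]].
    move: aF bF; rewrite !inE !negbK => /eqP wa /eqP wb.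
    by apply/eqP; apply: (norm_prime_degree_fix2 pr_T oX nXw ab wa wb).
  rewrite cardT; move: p_odd leF; clear; case: #|~: M| => [|[|]] // p_odd _.
    by rewrite addn0 => ->; rewrite addnC mul2n (half_bit_double p true).
  by move/eqP; rewrite eqn_add2r => /eqP->; rewrite mul2n doubleK.
have ov : #[v] = q.
  have : #[v] %| q by rewrite order_dvdn vq1.
  by case/primeP: pr_T => _ /[apply] /orP[|/eqP //]; rewrite order_eq1 (negPf v1).
apply/eqP; rewrite eq_sym eqEcard cycle_subG oX -orderE ov leqnn andbT.
have sylX : q.-Sylow('N(X)) X.
  by apply: pHall_subl (Sylow_prime_degree pr_T oX); rewrite ?normG ?subsetT.
by rewrite (mem_normal_Hall sylX (normalG X)) // /p_elt ov pnat_id.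
Qed.

(** If [v] and [w] both have powers of order p, these contradict the hypothesis directly. Otherwise
    one of them generates its group, the other normalises that group too, and some group of order p
    normalises both [X] and [Y]. *)
Lemma far_apart X Y v w : #|X| = q -> #|Y| = q ->
    (forall P Q, P \in normalizing p X -> Q \in normalizing p Y -> ~~ solvable (P <*> Q)) ->
    v \in 'N(X) -> w \in 'N(Y) -> v \in 'Alt_T -> w \in 'Alt_T -> v != 1 -> w != 1 ->
  ~~ solvable <<[set v; w]>>.
Proof.
move=> oX oY insol nXv nYw Av Aw v1 w1; apply/negP=> solvw.
have norms n (u : {perm T}) (Z : {group {perm T}}) : 
    #[u ^+ n] = p -> u \in 'N(Z) -> <[u ^+ n]>%G \in normalizing p Z.
  by move=> on nZu; rewrite inE -orderE on eqxx cycle_subG groupX.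
have same P : P \in normalizing p X -> P \in normalizing p Y -> False.
  move=> PX PY; have /negP := insol P P PX PY; apply.
  move: PX; rewrite inE => /andP[/eqP oP _].
  by rewrite joingE setUid genGid abelian_sol // cyclic_abelian // prime_cyclic ?oP.
have [p_v|defX] := norm_Alt_cases oX nXv Av v1.
  have [n on] := order_prime_power pr_p p_v; have PX := norms n v X on nXv.
  have [p_w|defY] := norm_Alt_cases oY nYw Aw w1.
    have [m om] := order_prime_power pr_p p_w; have QY := norms m w Y om nYw.
    case/negP: (insol _ _ PX QY); apply: solvableS solvw.
    by rewrite join_subG !cycle_subG !groupX // mem_gen ?set21 ?set22.
  apply: (same _ PX); apply: norms on _; rewrite defY.
  by apply: solvable_cycle_norm; rewrite ?orderE -?defY // setUC.
have nXw : w \in 'N(X).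
  by rewrite defX; apply: solvable_cycle_norm; rewrite ?orderE -?defX.
have [p_w|defY] := norm_Alt_cases oY nYw Aw w1.
  have [m om] := order_prime_power pr_p p_w.
  by apply: (same <[w ^+ m]>%G); apply: norms.
have [p_w|defX'] := norm_Alt_cases oX nXw Aw w1.
  have [m om] := order_prime_power pr_p p_w.
  by apply: (same <[w ^+ m]>%G); apply: norms.
(* Here [X] and [Y] coincide, so any [z] of order p in the normaliser will do; the exponent 1 below
   matches the form of [norms]. *)
have [z nXz oz] : {z | z \in 'N(X) & #[z] = p}.
  by apply: Cauchy; rewrite // card_norm_prime_degree // cardT addn1 /= !dvdn_mull.
apply: (same <[z ^+ 1]>%G); apply: norms; rewrite ?expg1 //.
by rewrite defY -defX'.
Qed.

End Neighbours.

Section Walks.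

Variables (V : finType) (r : rel V).

(** Adjacency in the soluble graph requires distinct vertices, whereas the vertices of the walk
    built for the upper bound may coincide. *)
Lemma path_neq_shorten x s : path r x s ->
  exists s', [/\ path (fun u v => (u != v) && r u v) x s', last x s' = last x s
    & size s' <= size s].
Proof.
elim: s x => [|y s IHs] x /=; first by exists [::].
case/andP=> rxy /IHs[s' [ps' ls' ss']].
have [xy|nxy] := eqVneq x y; first by exists s'; rewrite xy; split=> //; apply: leqW.
by exists (y :: s'); split; rewrite //= nxy rxy.
Qed.

End Walks.

Lemma sol_radical_Alt (T : finType) : 4 < #|T| -> sol_radical 'Alt_T :=: 1.
Proof.
move=> T5; have /simpleP[_ simA] := simple_Alt5 T5.
case: (simA _ (sol_radical_normal _)) => // RA.
by have := sol_radical_sol 'Alt_T; rewrite RA solvable_AltF.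
Qed.

Lemma sol_diameter_Alt (T : finType) (p : nat) :
    5 <= p -> prime p -> #|T| = (2 * p + 1)%N -> prime #|T| ->
  sol_diameter 'Alt_T = Some 4 \/ sol_diameter 'Alt_T = Some 5.
Proof.
move=> p_ge5 pr_p cardT pr_T.
have T5 : 4 < #|T| by rewrite cardT addn1 ltnS (leq_trans (ltnW p_ge5)) // leq_pmull.
set V : finType := sol_vertex 'Alt_T.
have vertP (g : {perm T}) : (g \in 'Alt_T :\: sol_radical 'Alt_T) = (g \in 'Alt_T) && (g != 1).
  by rewrite inE sol_radical_Alt // inE andbC.
have vertex g : g \in 'Alt_T -> g != 1 -> {x : V | val x = g}.
  move=> Ag g1; have Vg : g \in 'Alt_T :\: sol_radical 'Alt_T by rewrite vertP Ag.
  by exists (Sub g Vg); rewrite SubK.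
have valV (x : V) : val x \in 'Alt_T /\ val x != 1.
  by have := valP x; rewrite vertP => /andP.
have [connV gdist5] : (forall x y, connect (@sol_adj _ 'Alt_T) x y) /\
    forall x y, gdist (@sol_adj _ 'Alt_T) x y <= 5.
  have short x y : exists s, [/\ path (@sol_adj _ 'Alt_T) x s, last x s = y & size s <= 5].
    have p_odd := odd_prime_geq5 p_ge5 pr_p.
    have T_odd : odd #|T| by rewrite cardT addn1 mul2n /= odd_double.
    have dv_p : p %| #|T|.-1 by rewrite cardT addn1 dvdn_mull.
    have near (v : V) : exists z t : V, [/\ #[val t] = 2,
        solvable <<[set val v; val z]>> & solvable <<[set val z; val t]>>].
      have [Av v1] := valV v.
      have [z [t [Az z1 At ot /andP[svz szt]]]] 
        := near_involution pr_T T_odd pr_p p_odd dv_p Av v1.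
      have [z' ez] := vertex z Az z1.
      have t1 : t != 1 by apply: contra_eq_neq ot => ->; rewrite order1.
      have [t' et] := vertex t At t1.
      by exists z', t'; rewrite ez et.
    have [z [t [ot sxz szt]]] := near x; have [z' [t' [ot' syz' sz't']]] := near y.
    (* The middle edge joins two involutions. *)
    have [|s [ps ls ss]] := @path_neq_shorten V
        (fun u v => solvable <<[set val u; val v]>>) x [:: z; t; t'; z'; y].
      rewrite /= sxz szt solvable_involutions //= andbT.
      by apply/andP; split; rewrite setUC.
    by exists s.
  have conn x y : connect (@sol_adj _ 'Alt_T) x y.
    by have [s [ps ls _]] := short x y; apply/connectP; exists s.
  split=> // x y; have [s [ps ls ss]] := short x y.
  apply: leq_trans ss; apply: (gdistP (conn x y)).2.
  by apply/walkP; exists s.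
have [x [y gdist4]] : exists x y, 4 <= gdist (@sol_adj _ 'Alt_T) x y.
  have [g _ og] : {g | g \in [set: {perm T}] & #[g] = #|T|}.
    apply: Cauchy => //; rewrite card_setTperm // dvdn_fact //.
    by rewrite leqnn prime_gt0.
  pose X := <[g]>%G; have oX : #|X| = #|T| := og.
  have [Y oY insol] := exists_insoluble_prime_degree pr_p p_ge5 cardT pr_T oX.
  have [h defY oh] := prime_degree_cycle pr_T oY.
  have T_odd : odd #|T| by rewrite cardT addn1 mul2n /= odd_double.
  have vert_q f : #[f] = #|T| -> {x : V | val x = f}.
    move=> of_; apply: vertex; first by rewrite odd_order_Alt ?of_.
    by apply: contra_eq_neq of_ => ->; rewrite order1 neq_ltn prime_gt1.
  have [x ex] := vert_q g og; have [y ey] := vert_q h oh.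
  have far (v w : V) : val v \in 'N(X) -> val w \in 'N(Y) ->
      ~~ solvable <<[set val v; val w]>>.
    move=> nXv nYw; have [Av v1] := valV v; have [Aw w1] := valV w.
    exact: (far_apart pr_p p_ge5 cardT pr_T oX oY insol).
  have nXx : val x \in 'N(X) by rewrite ex (subsetP (normG X)) ?cycle_id.
  have nYy : val y \in 'N(Y) by rewrite ey (subsetP (normG Y)) // defY cycle_id.
  have nbrX v : sol_adj x v -> val v \in 'N(X).
    by case/andP=> _; rewrite ex => /(solvable_cycle_norm pr_T og).
  have nbrY v : sol_adj v y -> val v \in 'N(Y).
    by case/andP=> _; rewrite ey setUC defY => /(solvable_cycle_norm pr_T oh).
  have far1 (v : V) : val v \in 'N(X) -> val v \in 'N(Y) -> False.
    move=> nXv nYv; case/negP: (far v v nXv nYv).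
    by rewrite -{2}[val v]expg1 solvable_powers.
  (* A walk of length at most 3 has two equal or adjacent vertices, one normalising [X] and the
     other [Y]; [far1] and [far] exclude this. *)
  exists x, y; rewrite leqNgt; apply/negP=> lt4.
  have [/walkP[s [szs ps ls]] _] := gdistP (connV x y).
  rewrite -szs in lt4; case: s {szs} lt4 ps ls => [|v1 [|v2 [|v3 [|v4 s]]]] //= _.
  - by move=> _ exy; apply: (far1 x); rewrite // {1}exy.
  - by rewrite andbT => /nbrX n1 exy; apply: (far1 v1); rewrite // exy.
  - case/and3P=> /nbrX n1 a2 _ exy; apply: (far1 v1) => //.
    by apply: nbrY; rewrite -exy.
  case/and4P=> /nbrX n1 a12 a23 _ exy; have n2 : val v2 \in 'N(Y) by apply: nbrY; rewrite -exy.
  by case/negP: (far v1 v2 n1 n2); case/andP: a12.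
rewrite /sol_diameter /diameter ifT; last by apply/forallP=> u; apply/forallP.
set m := \max_u _; have m5 : m <= 5.
  by apply/bigmax_leqP=> u _; apply/bigmax_leqP=> v _.
have m4 : 4 <= m.
  by apply: leq_trans gdist4 _; apply: (bigmax_sup x) => //; apply: (bigmax_sup y).
by case: m m4 m5 => [|[|[|[|[|[|]]]]]] // _ _; [left | right].
Qed.

Local Close Scope group_scope.

Theorem theorem4 (p : nat) (p_ge5 : 5 <= p) (p_SG : sophie_germain p) :
  sol_diameter 'Alt_('I_(2 * p + 1))%G = Some 4 \/
  sol_diameter 'Alt_('I_(2 * p + 1))%G = Some 5.
Proof.
have [pr_p pr_q] := andP p_SG.
by apply: (sol_diameter_Alt p_ge5 pr_p); rewrite card_ord.
Qed.
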